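(* Let $a,b\in\mathbb{C}\setminus\{0\}$, $c>0$, $c>|a|+|b|+1$, and $0<\lambda\le1$. Suppose that $$\frac{\Gamma(c)\,\Gamma(c-|a|-|b|)}{\Gamma(|b|)\,\Gamma(c-|b|)}\Bigg[\sum_{n=0}^{\infty}\binom{-(|a|+1)}{n}\frac{|a|}{c-|a|-|b|-1}\,\frac{\Gamma(|b|+4+2n)}{\Gamma(c-|a|+3+2n)}\;{}_2F_1(|a|+1,|b|+4+2n;c-|a|+3+2n;-1)$$ $$+\lambda\sum_{n=0}^{\infty}\binom{-|a|}{n}\frac{\Gamma(|b|+2n)}{\Gamma(c-|a|+2n)}\;{}_2F_1(|a|,|b|+2n;c-|a|+2n;-1)\Bigg]\le 2\lambda .$$ Then the function $z\;{}_5F_4\left(a,\tfrac{b}{4},\tfrac{b+1}{4},\tfrac{b+2}{4},\tfrac{b+3}{4};\tfrac{c}{4},\tfrac{c+1}{4},\tfrac{c+2}{4},\tfrac{c+3}{4};z\right)$ belongs to the class $\mathcal{S}^*_\lambda$.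
   Context: $\mathbb{D}=\{z\in\mathbb{C}:|z|<1\}$. $\mathcal{A}$ is the family of functions $f(z)=z+\sum_{n\ge2}a_nz^n$ analytic in $\mathbb{D}$. For $\lambda>0$, $\mathcal{S}^*_\lambda=\{f\in\mathcal{A}:\ |zf'(z)/f(z)-1|<\lambda \text{ for all } z\in\mathbb{D}\}$. Pochhammer symbol: $(x)_0=1$, $(x)_n=x(x+1)\cdots(x+n-1)$; generalized binomial coefficient $\binom{-x}{n}=(-1)^n(x)_n/n!$. ${}_5F_4(a_1,\dots,a_5;b_1,\dots,b_4;z)=\sum_{n\ge0}\frac{(a_1)_n\cdots(a_5)_n}{(b_1)_n\cdots(b_4)_n\,(1)_n}z^n$ for $|z|<1$; ${}_2F_1(p,q;r;z)=\sum_{k\ge0}\frac{(p)_k(q)_k}{(r)_k(1)_k}z^k$ for $|z|<1$, extended as usual by analytic continuation to $z=-1$. *)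

(* Defs.v *)
From HB Require Import structures.
From mathcomp Require Import all_boot all_order all_algebra.
From mathcomp Require Import all_classical all_reals all_analysis.
From mathcomp Require Import complex.

Set Implicit Arguments.
Unset Strict Implicit.
Unset Printing Implicit Defensive.

Import Order.TTheory GRing.Theory Num.Theory numFieldNormedType.Exports.
Import ComplexField.

Local Open Scope classical_set_scope.
Local Open Scope ring_scope.
Local Open Scope complex_scope.

(* Complex numbers are [R[i]]; the norm topology lives on the regular module
   [R[i]^o], whence the [^o] casts wherever a limit or a derivative occurs. *)

Definition poch (K : nzRingType) (x : K) (n : nat) : K :=
  \prod_(i < n) (x + i%:R).

(* [binomN x n] is the binomial coefficient "-x choose n". *)
Definition binomN (R : realType) (x : R) (n : nat) : R :=
  (-1) ^+ n * poch x n / (n`!)%:R.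

(* Real-valued Lebesgue integral; only meaningful for [0 < x]. *)
Definition Gamma (R : realType) (x : R) : R :=
  \int[lebesgue_measure]_(t in `]0, +oo[) (t `^ (x - 1) * expR (- t)).

Definition disc (R : realType) : set R[i] := [set z | `|z| < 1].

Definition holomorphic_on (R : realType) (U : set R[i]) (f : R[i] -> R[i]) :=
  forall z, U z -> @derivable R[i] R[i]^o R[i]^o f z 1.

Definition cderiv (R : realType) (f : R[i] -> R[i]) (z : R[i]) : R[i] :=
  @derive R[i] R[i]^o R[i]^o f z 1.

(* Sum of the generalized hypergeometric series with upper parameters [us] and
   lower parameters [ls]; only meaningful where the series converges. *)
Definition hypergeom (R : realType) (us ls : seq R[i]) (z : R[i]) : R[i] :=
  limn (series (fun n =>
    (\prod_(u <- us) poch u n) / ((\prod_(l <- ls) poch l n) * poch 1 n)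
      * z ^+ n : R[i]^o)).

(* [w] is the value at [z] of the analytic continuation of [g] from the unit
   disc along the segment from 0 to [z]. Two open sets that are star-shaped
   about 0 have a star-shaped, hence connected, intersection, so [w] is unique;
   for a 2F1 the largest such [U] is the plane cut along [1, +oo[, on which the
   continuation is the principal branch. *)
Definition star_continuation (R : realType) (g : R[i] -> R[i]) (z w : R[i]) :=
  exists (U : set R[i]) (F : R[i] -> R[i]),
    [/\ open (U : set R[i]^o),
        (forall u (t : R), U u -> 0 <= t <= 1 -> U (t%:C * u)),
        @disc R `<=` U /\ U z,
        holomorphic_on U F /\ (forall u, disc u -> F u = g u)
      & F z = w].

(* The default value 0 is used only where there is no continuation. *)
Definition hyp2F1 (R : realType) (p q r z : R[i]) : R[i] :=
  xget 0 [set w | star_continuation (hypergeom [:: p; q] [:: r]) z w].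

Definition hyp5F4 (R : realType) (a1 a2 a3 a4 a5 b1 b2 b3 b4 z : R[i]) : R[i] :=
  hypergeom [:: a1; a2; a3; a4; a5] [:: b1; b2; b3; b4] z.

Definition classA (R : realType) (f : R[i] -> R[i]) :=
  holomorphic_on (@disc R) f /\
  exists a : nat -> R[i], [/\ a 0%N = 0, a 1%N = 1
    & forall z, disc z ->
        series (fun n => a n * z ^+ n : R[i]^o) @ \oo --> (f z : R[i]^o)].

(* At 0 the quotient [z f'(z) / f(z)] has a removable singularity with value 1,
   where the inequality is trivial. Elsewhere [f z != 0] says that the quotient
   is defined, since division is total here. *)
Definition starlike_class (R : realType) (lambda : R) (f : R[i] -> R[i]) :=
  classA f /\
  forall z, disc z -> z != 0 ->
    f z != 0 /\ `|z * cderiv f z / f z - 1| < lambda%:C.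

(* Main.v *)
(* Write A = |a|, B = |b| and let T_n = (A)_n (B)_{4n} / ((c)_{4n} n!), which
   bounds the modulus of the n-th Taylor coefficient of the 5F4. As
   |z f' - f| <= sum n T_n |z|^(n+1), it suffices that
   sum (n + lambda) T_n <= 2 lambda.  By Euler's Beta integral, sum T_n equals,
   up to Gamma factors, the integral of t^(B-1) (1-t)^(c-B-1) (1-t^4)^(-A) over
   ]0, 1[.  Factor 1 - t^4 = (1 - t)(1 + t)(1 + t^2) and expand (1 + t^2)^(-A):
   the n-th term is an Euler integral of a 2F1 at -1, which gives the second
   series of the hypothesis; the first one is the same for sum n T_n.  The
   expansion need not converge absolutely at t = 1, but the assumed convergence
   of the resulting series makes the interchange legitimate by Abel's theorem.
   The continuation of the 2F1 to -1 is exhibited as a single power series about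
   -1/2, whose disc of convergence contains both the unit disc and -1. *)
Require Import Defs.
From HB Require Import structures.
From mathcomp Require Import all_boot all_order all_algebra.
From mathcomp Require Import all_classical all_reals all_analysis.
From mathcomp Require Import measurable_realfun.
From mathcomp Require Import complex.
From mathcomp Require Import ring lra zify.

Set Implicit Arguments.
Unset Strict Implicit.
Unset Printing Implicit Defensive.

Import Order.TTheory GRing.Theory Num.Theory numFieldNormedType.Exports.
Import ComplexField.

Local Open Scope classical_set_scope.
Local Open Scope ring_scope.
Local Open Scope complex_scope.

(** * Affine changes of variable *)

(** [Gamma] is a bare integral, so its finiteness, its functional equation and Euler's Beta integral
    are all derived here, from one use of Tonelli's theorem on a convolution. The centre -1/2 is a
    convenience: for any x > 0 the disc about -x of radius 1 + x contains -1 and the unit disc, and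
    has the singularity 1 on its boundary. What matters is positivity. For positive parameters the
    coefficients about 0 and about -1/2 are nonnegative, so the two expansions can be compared
    through real partial sums at |u|, without rearranging a double series. The assumed inequality is
    weak while the class asks for a strict one. The margin comes from the term n = 1: its
    coefficient T_1 is positive and it is multiplied by |z| < 1. *)

Lemma affine_mfun (R : realType) (a b : R) :
  exists phi : {mfun measurableTypeR R >-> measurableTypeR R},
    forall x : R, phi x = a * x + b.
Proof.
have [phi phiE] : exists phi : measurableTypeR R -> measurableTypeR R,
    phi = (fun x : R => a * x + b) by eexists.
have mphi : measurable_fun [set: measurableTypeR R] phi.
  by rewrite phiE; apply: measurable_funD => //; exact: measurable_funM.
pose mix := isMeasurableFun.Build _ _ _ _ _ mphi.
pose phi' : {mfun measurableTypeR R >-> measurableTypeR R} := HB.pack phi mix.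
by exists phi' => x; rewrite /phi'/= phiE.
Qed.

(** Lebesgue measure equals [a] times its pushforward under the affine map: the two agree on
    half-open intervals, and that determines the measure. *)
Lemma ge0_integral_affine (R : realType) (a b : R) (f : R -> \bar R) : 0 < a ->
  measurable_fun [set: R] f -> (forall x, 0 <= f x)%E ->
  (\int[lebesgue_measure]_x f x =
   a%:E * \int[lebesgue_measure]_x f (a * x + b)%R)%E.
Proof.
move=> a0 mf f0.
have [phi phiE] := affine_mfun a b.
pose an := NngNum (ltW a0).
have mphi : measurable_fun [set: measurableTypeR R] phi by [].
pose pm :=
  measure_function_pushforward__canonical__measure_function_Measure
    (@lebesgue_measure R) mphi.
pose m := mscale an pm.
have mE A : measurable A -> lebesgue_measure A = m A.
  apply: (@lebesgue_measure_unique R m) => // X [[l r]] _ <-.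
  rewrite -[RHS]/(a%:E * lebesgue_measure (phi @^-1` [set` `]l, r]]))%E.
  have -> : phi @^-1` [set` `]l, r]] = [set` `](l - b) / a, (r - b) / a]].
    apply/seteqP; split => x; rewrite /= phiE !in_itv/= ltr_pdivrMr// ler_pdivlMr//.
      by rewrite ltrBlDr lerBrDr mulrC.
    by rewrite ltrBlDr lerBrDr mulrC.
  rewrite lebesgue_measure_itv/= lebesgue_measure_itv/= !lte_fin.
  rewrite ltr_pM2r ?invr_gt0// ltrD2r.
  case: ifPn => _; last by rewrite mule0.
  rewrite -!EFinB -EFinM; congr (_%:E).
  by field; rewrite gt_eqF.
transitivity (\int[m]_x f x)%E.
  by apply: eq_measure_integral => A mA _; exact: mE.
rewrite ge0_integral_mscale//; congr (_ * _)%E.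
rewrite ge0_integral_pushforward//.
by apply: eq_integral => x _; rewrite /= phiE.
Qed.

(** [ge0_integral_affine] covers positive slopes only, so the reflection comes from the invariance
    of Lebesgue measure under negation, and just the shift from that lemma. *)
Lemma ge0_integral_onem (R : realType) (f : R -> \bar R) :
  measurable_fun [set: R] f -> (forall x, 0 <= f x)%E ->
  (\int[lebesgue_measure]_x f x = \int[lebesgue_measure]_x f (1 - x)%R)%E.
Proof.
move=> mf f0.
transitivity (\int[lebesgue_measure]_x f (- x)%R)%E; last first.
  have mfN : measurable_fun [set: R] (fun x : R => f (- x)%R).
    exact: (measurableT_comp mf).
  rewrite (@ge0_integral_affine R 1 (-1) (fun x : R => f (- x)%R))// mul1e.
  by apply: eq_integral => x _; rewrite mul1r opprB.
have [phi phiE] := affine_mfun (-1 : R) 0.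
transitivity (\int[pushforward (@lebesgue_measure R) phi]_x f x)%E.
  apply: eq_measure_integral => A mA _.
  apply: (etrans (esym (lebesgue_measureN mA))).
  rewrite /pushforward; congr lebesgue_measure.
  by apply/seteqP; split => x /=; rewrite phiE addr0 mulN1r.
rewrite ge0_integral_pushforward//.
by apply: eq_integral => x _; rewrite /= phiE addr0 mulN1r.
Qed.

(** * Gamma and Beta integrals *)

(** If the integral vanished, [f] would be zero almost everywhere on [D], and [D] would lie in a
    null set. *)
Lemma integral_gt0_pos (R : realType) (D : set R) (f : R -> R) :
  measurable D -> measurable_fun D f -> (forall x, D x -> 0 < f x) ->
  (0 < (@lebesgue_measure R) D)%E ->
  (0 < \int[lebesgue_measure]_(x in D) (f x)%:E)%E.
Proof.
move=> mD mf f0 D0.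
have ge0 : (0 <= \int[lebesgue_measure]_(x in D) (f x)%:E)%E.
  by apply: integral_ge0 => x Dx; rewrite lee_fin ltW// f0.
rewrite lt_neqAle ge0 andbT; apply/eqP => /esym I0.
have I1 : (\int[lebesgue_measure]_(x in D) `|(f x)%:E|)%E = 0%E.
  rewrite -[RHS]I0; apply: eq_integral => x /set_mem Dx.
  by rewrite gee0_abs// lee_fin ltW// f0.
have mfE : measurable_fun D (EFin \o f) by exact/measurable_EFinP.
have [+ _] := ae_eq_integral_abs (@lebesgue_measure R) mD mfE.
move=> /(_ I1) [N [mN N0 sub]].
suff : (lebesgue_measure D <= lebesgue_measure N)%E by rewrite N0 leNgt D0.
apply: le_measure; rewrite ?inE// => x Dx; apply: sub => /= H.
by have := f0 x Dx; have := H Dx; case=> ->; rewrite ltxx.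
Qed.

(** Extending the integrands by zero to the whole line lets substitutions, convolutions and
    Tonelli's theorem run without bookkeeping of domains. *)
Definition gamma_ker (R : realType) (x : R) : R -> R :=
  (fun t => t `^ (x - 1) * expR (- t)) \_ `]0, +oo[.

Definition beta_ker (R : realType) (x y : R) : R -> R :=
  (fun t => t `^ (x - 1) * (1 - t) `^ (y - 1)) \_ `]0, 1[.

Lemma gamma_kerE (R : realType) (x t : R) :
  gamma_ker x t = if 0 < t then t `^ (x - 1) * expR (- t) else 0.
Proof. by rewrite /gamma_ker patchE mem_setE in_itv/= andbT. Qed.

Lemma beta_kerE (R : realType) (x y t : R) : beta_ker x y t =
  if 0 < t < 1 then t `^ (x - 1) * (1 - t) `^ (y - 1) else 0.
Proof. by rewrite /beta_ker patchE mem_setE in_itv/=. Qed.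

Lemma gamma_ker_ge0 (R : realType) (x t : R) : 0 <= gamma_ker x t.
Proof. by rewrite gamma_kerE; case: ifP => // _; rewrite mulr_ge0 ?powR_ge0 ?expR_ge0. Qed.

Lemma beta_ker_ge0 (R : realType) (x y t : R) : 0 <= beta_ker x y t.
Proof. by rewrite beta_kerE; case: ifP => // _; rewrite mulr_ge0 ?powR_ge0. Qed.

Lemma measurable_gamma_ker (R : realType) (x : R) :
  measurable_fun [set: R] (gamma_ker x).
Proof.
apply/measurable_restrict => //; apply: measurable_funTS.
apply: measurable_funM; first exact: measurable_powR.
by apply: measurableT_comp.
Qed.

Lemma measurable_beta_ker (R : realType) (x y : R) :
  measurable_fun [set: R] (beta_ker x y).
Proof.
apply/measurable_restrict => //; apply: measurable_funTS.
apply: measurable_funM; first exact: measurable_powR.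
apply: (measurableT_comp (measurable_powR _)).
exact: measurable_funB.
Qed.

Lemma integral_gamma_ker (R : realType) (x : R) :
  (\int[lebesgue_measure]_(t in `]0%R, +oo[) (t `^ (x - 1) * expR (- t))%:E =
   \int[lebesgue_measure]_t (gamma_ker x t)%:E)%E.
Proof. by rewrite integral_mkcond restrict_EFin. Qed.

Lemma integral_beta_ker (R : realType) (x y : R) :
  (\int[lebesgue_measure]_(t in `]0%R, 1%R[)
     (t `^ (x - 1) * (1 - t) `^ (y - 1))%:E =
   \int[lebesgue_measure]_t (beta_ker x y t)%:E)%E.
Proof. by rewrite integral_mkcond restrict_EFin. Qed.

(* The substitution [s = u v] for [u > 0]. *)
Lemma gamma_ker_convolution (R : realType) (x y u : R) :
  (\int[lebesgue_measure]_s (gamma_ker x s * gamma_ker y (u - s))%:E =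
   (gamma_ker (x + y) u)%:E * \int[lebesgue_measure]_v (beta_ker x y v)%:E)%E.
Proof.
have [u0|u0] := leP u 0.
  rewrite integral0_eq; first by rewrite gamma_kerE ltNge u0 mul0e.
  move=> s _; rewrite !gamma_kerE subr_gt0; congr EFin.
  case: ltP => s0; last by rewrite mul0r.
  by case: ltP => su; rewrite ?mulr0//; lra.
rewrite (@ge0_integral_affine _ u 0)//; first last.
- by move=> s; rewrite lee_fin mulr_ge0// gamma_ker_ge0.
- apply/measurable_EFinP; apply: measurable_funM.
    exact: measurable_gamma_ker.
  apply: (measurableT_comp (measurable_gamma_ker _)).
  exact: measurable_funB.
transitivity (u%:E * \int[lebesgue_measure]_v
   ((u `^ (x - 1) * u `^ (y - 1) * expR (- u))%:E * (beta_ker x y v)%:E))%E.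
  congr (_ * _)%E; apply: eq_integral => v _.
  rewrite addr0 -EFinM; congr EFin.
  rewrite !gamma_kerE beta_kerE pmulr_rgt0// (_ : u - u * v = u * (1 - v)); last by ring.
  rewrite pmulr_rgt0// subr_gt0.
  case: ltP => v0/=; last by rewrite mul0r mulr0.
  case: ltP => v1/=; last by rewrite !mulr0.
  rewrite !powRM ?subr_ge0// ?ltW//.
  have -> : - u = - (u * v) + - (u * (1 - v)) by ring.
  by rewrite expRD; ring.
rewrite ge0_integralZl_EFin//; first last.
- by rewrite !mulr_ge0 ?powR_ge0 ?expR_ge0.
- by apply/measurable_EFinP; exact: measurable_beta_ker.
- by move=> v _; rewrite lee_fin beta_ker_ge0.
rewrite muleA -EFinM gamma_kerE u0; congr (_%:E * _)%E.
rewrite !mulrA -{1}(powRr1 (ltW u0)); congr (_ * _).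
rewrite -!powRD; last 2 first.
- by rewrite (gt_eqF u0) implybT.
- by rewrite (gt_eqF u0) implybT.
by congr powR; ring.
Qed.

(** Both sides are iterated integrals of [gamma_ker x s * gamma_ker y (u - s)], in opposite orders.
    The identity lives in the extended reals, hence is available before any of the integrals is
    known to be finite. *)
Lemma integral_gammaM (R : realType) (x y : R) :
  ((\int[lebesgue_measure]_t (gamma_ker x t)%:E) *
   (\int[lebesgue_measure]_t (gamma_ker y t)%:E) =
   (\int[lebesgue_measure]_t (gamma_ker (x + y) t)%:E) *
   (\int[lebesgue_measure]_v (beta_ker x y v)%:E))%E.
Proof.
have mE (z : R) : measurable_fun [set: R] (fun t => (gamma_ker z t)%:E).
  by apply/measurable_EFinP; exact: measurable_gamma_ker.
rewrite -(@ge0_integralZr _ _ R lebesgue_measure _ measurableT _ (mE x)); first last.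
- by apply: integral_ge0 => t _; rewrite lee_fin gamma_ker_ge0.
- by move=> t _; rewrite lee_fin gamma_ker_ge0.
rewrite -(@ge0_integralZr _ _ R lebesgue_measure _ measurableT _ (mE (x + y))); first last.
- by apply: integral_ge0 => t _; rewrite lee_fin beta_ker_ge0.
- by move=> t _; rewrite lee_fin gamma_ker_ge0.
under [RHS]eq_integral do rewrite -gamma_ker_convolution.
transitivity (\int[lebesgue_measure]_s \int[lebesgue_measure]_u
   (gamma_ker x s * gamma_ker y (u - s))%:E)%E.
  apply: eq_integral => s _.
  rewrite (@ge0_integral_affine _ 1 (- s) (fun t => (gamma_ker y t)%:E))//; last first.
    by move=> t; rewrite lee_fin gamma_ker_ge0.
  rewrite mul1e -ge0_integralZl_EFin; last exact: gamma_ker_ge0.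
  - by apply: eq_integral => u _; rewrite mul1r EFinM.
  - by [].
  - by move=> t _; rewrite lee_fin gamma_ker_ge0.
  - apply/measurable_EFinP; apply: (measurableT_comp (measurable_gamma_ker _)).
    by apply: measurable_funD => //; exact: measurable_funM.
rewrite (@fubini_tonelli _ _ _ _ _ lebesgue_measure lebesgue_measure
  (fun z : R * R => (gamma_ker x z.1 * gamma_ker y (z.2 - z.1))%:E))//.
- apply/measurable_EFinP; apply: measurable_funM.
    exact: (measurableT_comp (measurable_gamma_ker _)).
  apply: (measurableT_comp (measurable_gamma_ker _)).
  exact: measurable_funB.
- by move=> z; rewrite lee_fin mulr_ge0// gamma_ker_ge0.
Qed.

Lemma continuous_powR_gt0 (R : realType) (x t : R) : 0 < t ->
  {for t, continuous (fun u : R => u `^ x)}.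
Proof.
move=> t0; apply: differentiable_continuous; apply/derivable1_diffP.
by apply: derivable_powR; rewrite in_itv/= t0.
Qed.

Lemma integral_powR_itvcc (R : realType) (x a : R) : 0 < x -> 0 < a <= 1 ->
  (\int[lebesgue_measure]_(t in `[a, 1%R]) (t `^ (x - 1))%:E =
   (x^-1 * (1 - a `^ x))%:E)%E.
Proof.
move=> x0 /andP[a0]; rewrite le_eqVlt => /predU1P[->|a1].
  by rewrite set_itv1 integral_set1 powR1 subrr mulr0.
have cF (t : R) : 0 < t -> {for t, continuous (fun u : R => x^-1 * u `^ x)}.
  move=> t0; apply: continuousM; first exact: cst_continuous.
  exact: continuous_powR_gt0.
rewrite (@continuous_FTC2 _ _ (fun t => x^-1 * t `^ x))//.
- by rewrite powR1/= -EFinB; congr EFin; ring.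
- apply: continuous_in_subspaceT => t; rewrite inE/= in_itv/= => /andP[at_ _].
  by apply: continuous_powR_gt0; exact: lt_le_trans at_.
- split.
  + move=> t; rewrite in_itv/= => /andP[at_ _].
    apply: derivableM => //.
    by apply: derivable_powR; rewrite in_itv/= (lt_trans a0).
  + by apply: cvg_at_right_filter; exact: cF.
  + by apply: cvg_at_left_filter; exact: cF.
- move=> t; rewrite in_itv/= => /andP[at_ _].
  have t0 : 0 < t by exact: lt_trans at_.
  rewrite derive1E.
  have D := @derive_val _ _ _ _ _ _ _ (is_deriveZ x^-1 (is_derive1_powR x t0)).
  by apply: (etrans D); rewrite /GRing.scale/= mulrA mulVf ?mul1r// gt_eqF.
Qed.

(** For x < 1 the integrand blows up at 0, so the interval is exhausted by the segments
    [1/(n+1), 1], on which the fundamental theorem of calculus applies. *)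
Lemma integral_beta_ker1 (R : realType) (x : R) : 0 < x ->
  (\int[lebesgue_measure]_t (beta_ker x 1 t)%:E = (x^-1)%:E)%E.
Proof.
move=> x0.
have mf D : measurable_fun D (fun t : R => (t `^ (x - 1))%:E).
  apply/measurable_EFinP; apply: measurable_funTS; exact: measurable_powR.
rewrite -integral_beta_ker subrr.
under eq_integral do rewrite powRr0 mulr1.
rewrite integral_itv_bndo_bndc// itv_open_bnd_bigcup.
pose F n := `[0 + n.+1%:R^-1, 1 : R]%classic.
have ndF : nondecreasing_seq F.
  move=> m n mn; apply/subsetPset => t; rewrite /F/= !in_itv/= => /andP[h ->].
  rewrite andbT (le_trans _ h)// lerD2l lef_pV2 ?posrE ?ltr0n//.
  by rewrite ler_nat.
have H : ((\int[lebesgue_measure]_(t in F n) (t `^ (x - 1))%:E)%E @[n --> \oo] -->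
    (\int[lebesgue_measure]_(t in \bigcup_n F n) (t `^ (x - 1))%:E)%E).
  apply: ge0_nondecreasing_set_cvg_integral.
  - exact: ndF.
  - by move=> i; exact: measurable_itv.
  - by move=> i; exact: mf.
  - by move=> i t _; rewrite lee_fin powR_ge0.
rewrite -(cvg_lim _ H)//; apply/cvg_lim => //.
rewrite (_ : (fun i => _) = (fun n => (x^-1 * (1 - (n.+1%:R^-1) `^ x))%:E)); last first.
  apply/funext => n; rewrite /F add0r integral_powR_itvcc//.
  by rewrite invr_gt0 ltr0n/= invf_le1 ?ltr0n// ler1n.
apply: cvg_EFin; first exact: nearW.
rewrite -[X in _ --> X]mulr1; apply: cvgM; first exact: cvg_cst.
rewrite -[X in _ --> X]subr0; apply: cvgB; first exact: cvg_cst.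
have /cvg_at_rightP := powR_cvg0 x0.
by apply; split; [move=> n; exact: harmonic_gt0|exact: cvg_harmonic].
Qed.

Lemma beta_ker_sym (R : realType) (x y t : R) :
  beta_ker x y (1 - t) = beta_ker y x t.
Proof.
rewrite !beta_kerE subKr mulrC.
by rewrite subr_gt0 ltrBlDr ltrDl andbC.
Qed.

Lemma integral_beta_ker_sym (R : realType) (x y : R) :
  (\int[lebesgue_measure]_t (beta_ker x y t)%:E =
   \int[lebesgue_measure]_t (beta_ker y x t)%:E)%E.
Proof.
rewrite ge0_integral_onem.
- by apply: eq_integral => t _; rewrite beta_ker_sym.
- by apply/measurable_EFinP; exact: measurable_beta_ker.
- by move=> t; rewrite lee_fin beta_ker_ge0.
Qed.

Lemma integral_beta_ker_lty (R : realType) (x y : R) : 0 < x -> 0 < y ->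
  (\int[lebesgue_measure]_t (beta_ker x y t)%:E < +oo)%E.
Proof.
move=> x0 y0.
(* [C z] bounds t^(z-1) on [1/2, 1[ whatever the sign of z - 1. On each half of the interval one
   factor of the kernel is thus bounded, and [g] adds the two resulting majorants. *)
pose C (z : R) := 1 + 2^-1 `^ (z - 1).
have C0 z : 0 <= C z by rewrite addr_ge0// powR_ge0.
have powC (z t : R) : 2^-1 <= t -> t < 1 -> t `^ (z - 1) <= C z.
  move=> t2 t1; have t0 : 0 < t by lra.
  have [z1|z1] := leP 0 (z - 1).
    rewrite (@le_trans _ _ 1)// ?lerDl ?powR_ge0//.
    by rewrite -[leRHS](powRr0 t); apply: ger_powR => //; rewrite t0 ltW.
  rewrite (@le_trans _ _ (2^-1 `^ (z - 1)))// ?lerDr//.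
  rewrite -[z - 1]opprK !(powRN _ (- (z - 1))).
  rewrite lef_pV2 ?posrE ?powR_gt0//.
  by apply: ge0_ler_powR; rewrite ?nnegrE; lra.
pose g t := C y * beta_ker x 1 t + C x * beta_ker 1 y t.
have m1 : measurable_fun [set: R] (fun t => (C y * beta_ker x 1 t)%:E).
  apply/measurable_EFinP; apply: measurable_funM => //.
  exact: measurable_beta_ker.
have m2 : measurable_fun [set: R] (fun t => (C x * beta_ker 1 y t)%:E).
  apply/measurable_EFinP; apply: measurable_funM => //.
  exact: measurable_beta_ker.
apply: (@le_lt_trans _ _ (\int[lebesgue_measure]_t (g t)%:E)%E).
  apply: ge0_le_integral => //.
  - by move=> t _; rewrite lee_fin beta_ker_ge0.
  - by apply/measurable_EFinP; exact: measurable_beta_ker.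
  - by apply/measurable_EFinP; apply: measurable_funD; exact/measurable_EFinP.
  move=> t _; rewrite lee_fin /g !beta_kerE.
  case: ifPn => [/andP[t0 t1]|_]; last by rewrite !mulr0 addr0.
  rewrite subrr !powRr0 mulr1 mul1r.
  have [t2|t2] := leP t 2^-1.
    rewrite -[leLHS]addr0 lerD ?mulr_ge0 ?powR_ge0//.
    rewrite [leRHS]mulrC ler_wpM2l ?powR_ge0//.
    by apply: powC; lra.
  rewrite -[leLHS]add0r lerD ?mulr_ge0 ?powR_ge0//.
  by rewrite ler_wpM2r ?powR_ge0//; apply: powC; lra.
under eq_integral do rewrite EFinD.
rewrite ge0_integralD//; first last.
- by move=> t _; rewrite lee_fin mulr_ge0// beta_ker_ge0.
- by move=> t _; rewrite lee_fin mulr_ge0// beta_ker_ge0.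
under eq_integral do rewrite EFinM.
under [X in (_ + X)%E]eq_integral do rewrite EFinM.
have mE z w : measurable_fun [set: R] (fun t => (beta_ker z w t)%:E).
  by apply/measurable_EFinP; exact: measurable_beta_ker.
have g0 z w t : setT t -> (0 <= (beta_ker z w t : R)%:E)%E.
  by rewrite lee_fin beta_ker_ge0.
rewrite ge0_integralZl_EFin//; [|exact: g0|exact: mE].
rewrite ge0_integralZl_EFin//; [|exact: g0|exact: mE].
rewrite (integral_beta_ker_sym 1) !integral_beta_ker1//.
by rewrite -!EFinM -EFinD ltry.
Qed.

Lemma integral_beta_ker_gt0 (R : realType) (x y : R) :
  (0 < \int[lebesgue_measure]_t (beta_ker x y t)%:E)%E.
Proof.
rewrite -integral_beta_ker; apply: integral_gt0_pos => //.
- apply: measurable_funTS; apply: measurable_funM; first exact: measurable_powR.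
  apply: (measurableT_comp (measurable_powR _)); exact: measurable_funB.
- move=> t; rewrite /= in_itv/= => /andP[t0 t1].
  by rewrite mulr_gt0// powR_gt0// subr_gt0.
- by rewrite lebesgue_measure_itv/= lte_fin ltr01 -EFinB subr0 lte_fin.
Qed.

Lemma integral_gamma_ker_gt0 (R : realType) (x : R) :
  (0 < \int[lebesgue_measure]_t (gamma_ker x t)%:E)%E.
Proof.
rewrite -integral_gamma_ker; apply: integral_gt0_pos => //.
- apply: measurable_funTS; apply: measurable_funM; first exact: measurable_powR.
  by apply: measurableT_comp.
- move=> t; rewrite /= in_itv/= andbT => t0.
  by rewrite mulr_gt0// ?powR_gt0// expR_gt0.
- by rewrite lebesgue_measure_itv/= ltry sube0 ltry.
Qed.

Lemma integral_gamma_ker1 (R : realType) :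
  (\int[lebesgue_measure]_t (gamma_ker (1 : R) t)%:E = 1)%E.
Proof.
rewrite -(@integral_exponential_pdf R 1 ltr01).
rewrite [RHS](_ : _ = \int[lebesgue_measure]_(t in `[0%R, +oo[) (expR (- t))%:E)%E.
  rewrite -integral_itv_obnd_cbnd; last first.
    by apply/measurable_EFinP; apply: measurable_funTS; exact: measurableT_comp.
  rewrite -integral_gamma_ker.
  by apply: eq_integral => t _; rewrite subrr powRr0 mul1r.
rewrite [RHS]integral_mkcond restrict_EFin; apply: eq_integral => t _.
rewrite /= /exponential_pdf !patchE; case: ifP => // _.
by rewrite mul1r mulN1r.
Qed.

(* For [x < 1] finiteness comes from [Gamma x * Gamma (1 - x) = Beta x (1 - x)],
   then one climbs by [Gamma (x - 1) = Gamma x / (x - 1)]. *)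
Lemma integral_gamma_ker_lty (R : realType) (x : R) : 0 < x ->
  (\int[lebesgue_measure]_t (gamma_ker x t)%:E < +oo)%E.
Proof.
have [n] : exists n : nat, x <= n.+1%:R.
  by exists (Num.truncn x); rewrite ltW// Num.Theory.truncnS_gt.
elim: n x => [x|n IHn x xn x0].
  rewrite le_eqVlt => /predU1P[-> _|x1 x0]; first by rewrite integral_gamma_ker1 ltry.
  have := integral_gammaM x (1 - x).
  rewrite subrKC integral_gamma_ker1 mul1e => E.
  have := @integral_beta_ker_lty _ x (1 - x) x0 _.
  rewrite subr_gt0 => /(_ x1); rewrite -E.
  have := integral_gamma_ker_gt0 x; have := integral_gamma_ker_gt0 (1 - x).
  set J := (\int[lebesgue_measure]_t (gamma_ker (1 - x) t)%:E)%E.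
  set I := (\int[lebesgue_measure]_t (gamma_ker x t)%:E)%E.
  (* An infinite [I] times the positive [J] would be infinite, against the finiteness of the Beta
     integral. *)
  case: I => [r||]//; first by rewrite ltry.
  case: J => [s||]// s0 _.
  by rewrite mulyr/= gtr0_sg -?lte_fin// mul1e.
have [x1|x1] := leP x 1; first by apply: (IHn x) => //; rewrite (le_trans x1)// ler1n.
have x10 : 0 < x - 1 by rewrite subr_gt0.
have := integral_gammaM (x - 1) 1.
rewrite subrK integral_gamma_ker1 mule1 integral_beta_ker1// => E.
have xn1 : x - 1 <= n.+1%:R by rewrite lerBlDr natr1.
have := IHn (x - 1) xn1 x10; rewrite E.
have := integral_gamma_ker_gt0 x.
case: (\int[_]_t _)%E => [r||]// _; first by rewrite !ltry.
by rewrite mulyr/= gtr0_sg ?invr_gt0// mul1e.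
Qed.

Lemma integral_gamma_kerE (R : realType) (x : R) : 0 < x ->
  (\int[lebesgue_measure]_t (gamma_ker x t)%:E = (Gamma x)%:E)%E.
Proof.
move=> x0; rewrite /Gamma /Rintegral integral_gamma_ker fineK//.
rewrite ge0_fin_numE ?integral_gamma_ker_lty//.
exact: ltW (integral_gamma_ker_gt0 x).
Qed.

Lemma Gamma_gt0 (R : realType) (x : R) : 0 < x -> 0 < Gamma x.
Proof.
by move=> x0; rewrite -lte_fin -integral_gamma_kerE// integral_gamma_ker_gt0.
Qed.

Lemma integral_beta_kerE (R : realType) (x y : R) : 0 < x -> 0 < y ->
  (\int[lebesgue_measure]_t (beta_ker x y t)%:E =
    (Gamma x * Gamma y / Gamma (x + y))%:E)%E.
Proof.
move=> x0 y0; have xy0 : 0 < x + y by exact: addr_gt0.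
have := integral_gammaM x y; rewrite !integral_gamma_kerE//.
have := integral_beta_ker_gt0 x y; have := integral_beta_ker_lty x0 y0.
case: (\int[_]_t _)%E => [r||]// _ _; rewrite -!EFinM => -[->].
by congr EFin; rewrite mulrAC mulfV ?mul1r// gt_eqF// Gamma_gt0.
Qed.

(** Read off from the Beta integral at (x, 1), which is 1/x, together with Gamma 1 = 1; no
    integration by parts is involved. *)
Lemma GammaD1 (R : realType) (x : R) : 0 < x -> Gamma (x + 1) = x * Gamma x.
Proof.
move=> x0; have x10 : 0 < x + 1 by rewrite addr_gt0.
have := integral_beta_kerE x0 ltr01; rewrite integral_beta_ker1// => -[].
have : Gamma (1 : R) = 1.
  by have := @integral_gamma_kerE R 1 ltr01; rewrite integral_gamma_ker1 => -[].
move=> ->; rewrite mulr1 => E.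
rewrite -[in RHS](divfK (lt0r_neq0 (Gamma_gt0 x10)) (Gamma x)) -E.
by rewrite mulrA mulfV ?mul1r// gt_eqF.
Qed.

Lemma pochS (K : nzRingType) (x : K) n : poch x n.+1 = poch x n * (x + n%:R).
Proof. by rewrite /poch big_ord_recr. Qed.

Lemma poch0 (K : nzRingType) (x : K) : poch x 0 = 1.
Proof. by rewrite /poch big_ord0. Qed.

Lemma poch_gt0 (R : numDomainType) (x : R) n : 0 < x -> 0 < poch x n.
Proof. by move=> x0; rewrite /poch prodr_gt0// => i _; rewrite ltr_wpDr. Qed.

Lemma pochSl (K : comNzRingType) (x : K) n : poch x n.+1 = x * poch (x + 1) n.
Proof.
rewrite /poch big_ord_recl addr0; congr (_ * _); apply: eq_bigr => i _.
by rewrite -addrA -natr1 [1 + _]addrC.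
Qed.

Lemma GammaDn (R : realType) (x : R) n : 0 < x ->
  Gamma (x + n%:R) = poch x n * Gamma x.
Proof.
move=> x0; elim: n => [|n IHn]; first by rewrite addr0 poch0 mul1r.
have xn : 0 < x + n%:R by rewrite ltr_wpDr.
rewrite -natr1 addrA (GammaD1 xn) IHn pochS.
by rewrite mulrA [_ * poch x n]mulrC.
Qed.

(** * Binomial series *)

(** Coefficients of (1 - x)^(-p). Without the alternating sign of [binomN] they are nonnegative for
    p > 0, which is what domination arguments need. *)
Definition binc (R : realType) (p : R) (n : nat) : R := poch p n / (n`!)%:R.

Lemma binc0 (R : realType) (p : R) : binc p 0 = 1.
Proof. by rewrite /binc poch0 fact0 divr1. Qed.

Lemma bincS (R : realType) (p : R) n :
  binc p n.+1 = binc p n * ((p + n%:R) / n.+1%:R).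
Proof. by rewrite /binc pochS factS natrM invfM; ring. Qed.

Lemma binc_ge0 (R : realType) (p : R) n : 0 < p -> 0 <= binc p n.
Proof. by move=> p0; rewrite divr_ge0// ltW// poch_gt0. Qed.

(** Coefficient form of differentiating (1 - x)^(-p). It serves twice: for the derivative of the
    binomial series, and to turn the sum of n T_n into a sum of the same type as that of T_n. *)
Lemma bincSl (R : realType) (p : R) n :
  n.+1%:R * binc p n.+1 = p * binc (p + 1) n.
Proof.
have f0 : n`!%:R != 0 :> R by rewrite pnatr_eq0 -lt0n fact_gt0.
have n0 : n.+1%:R != 0 :> R by rewrite pnatr_eq0.
rewrite /binc pochSl factS natrM; move: f0 n0.
move: n`!%:R n.+1%:R => f k f0 n0.
by field; rewrite ?f0 ?n0.
Qed.

Lemma bincD1 (R : realType) (p : R) n :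
  binc (p + 1) n.+1 - binc (p + 1) n = binc p n.+1.
Proof.
apply: (@mulfI _ n.+1%:R); first by rewrite pnatr_eq0.
rewrite bincSl bincS; field.
by rewrite nat1r pnatr_eq0.
Qed.

Lemma binc_geo_bounded (R : realType) (p q : R) : 0 <= q < 1 ->
  exists2 M, 0 <= M & forall n, `|binc p n| * q ^+ n <= M.
Proof.
move=> /andP[q0 q1].
pose a n := `|binc p n| * q ^+ n.
have a0 n : 0 <= a n by rewrite mulr_ge0// exprn_ge0.
(* For n >= N one has |p| <= n (1 - q), hence (|p| + n) q <= n, and the terms no longer increase. *)
pose N := (Num.truncn (`|p| / (1 - q))).+1.
have aN n : (N <= n)%N -> a n.+1 <= a n.
  move=> Nn; rewrite /a bincS exprS normrM.
  rewrite (_ : _ * _ = a n * (`|(p + n%:R) / n.+1%:R| * q)); last by rewrite /a; ring.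
  rewrite ler_piMr// normrM normfV (ger0_norm (ler0n _ _)).
  rewrite mulrAC ler_pdivrMr ?ltr0n// mul1r.
  have pn : `|p| <= n%:R * (1 - q).
    rewrite -ler_pdivrMr ?subr_gt0// ltW//.
    by rewrite (lt_le_trans (Num.Theory.truncnS_gt _))// ler_nat.
  rewrite (@le_trans _ _ ((`|p| + n%:R) * q))//.
    by rewrite ler_wpM2r// (le_trans (ler_normD _ _))// lerD2l ger0_norm.
  have : `|p| * q <= `|p| by rewrite ler_piMr// ltW.
  by rewrite -natr1; nra.
exists (\sum_(i < N.+1) a i); first by rewrite sumr_ge0.
have aS n : (n <= N)%N -> a n <= \sum_(i < N.+1) a i.
  move=> nN; rewrite (bigD1 (inord n))//= inordK ?ltnS// lerDl sumr_ge0//.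
move=> n; have [|Nn] := leqP n N; first exact: aS.
apply: le_trans (aS N (leqnn _)); rewrite -/(a n).
elim: n Nn => // n IHn; rewrite ltnS leq_eqVlt => /predU1P[<-|Nn].
  exact: aN.
by apply: le_trans (IHn Nn); exact/aN/ltnW.
Qed.

Lemma is_cvg_binc (R : realType) (p x : R) : `|x| < 1 ->
  cvgn (pseries (binc p) x).
Proof.
move=> x1.
pose q := (`|x| + 1) / 2.
have q0 : 0 < q by rewrite divr_gt0// ltr_wpDl.
have xq : `|x| < q by rewrite /q; lra.
have q1 : q < 1 by rewrite /q; lra.
have [|M M0 HM] := @binc_geo_bounded _ p q; first by rewrite ltW.
apply: normed_cvg; apply: (@series_le_cvg _ _ (geometric M (`|x| / q))) => [n|n|n|].
- exact: normr_ge0.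
- by rewrite /geometric/= mulr_ge0// exprn_ge0// divr_ge0// ltW.
- rewrite /= normrM normrX expr_div_n mulrA mulrAC.
  rewrite ler_wpM2r ?exprn_ge0//.
  by rewrite ler_pdivlMr ?exprn_gt0.
- apply: is_cvg_geometric_series; rewrite ger0_norm ?divr_ge0 // ?(ltW q0)//.
  by rewrite ltr_pdivrMr// mul1r.
Qed.

Lemma pseries_diffs_binc (R : realType) (p : R) :
  pseries_diffs (binc p) = p \*: binc (p + 1).
Proof. by apply/funext => n; rewrite /pseries_diffs bincSl. Qed.

Lemma pseriesZ (R : realType) (k x : R) (c : nat -> R) :
  pseries (k \*: c) x = k \*: pseries c x.
Proof.
apply/funext => n; rewrite /pseries /series/= /GRing.scale/= mulr_sumr.
by apply: eq_bigr => i _; rewrite mulrA.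
Qed.

Definition binser (R : realType) (p x : R) : R := limn (pseries (binc p) x).

Lemma is_derive_binser (R : realType) (p x : R) : `|x| < 1 ->
  is_derive x (1 : R) (binser p) (p * binser (p + 1) x).
Proof.
move=> x1; pose K := (`|x| + 1) / 2.
have K0 : 0 < K by rewrite divr_gt0// ltr_wpDl.
have xK : `|x| < `|K| by rewrite (gtr0_norm K0) /K; lra.
have K1 : `|K| < 1 by rewrite (gtr0_norm K0) /K; lra.
have E := pseries_diffs_binc p.
(* Termwise differentiation also asks that the second formal derivative converge; it is again a
   multiple of a binomial series. *)
have E2 : pseries_diffs (p \*: binc (p + 1)) = (p * (p + 1)) \*: binc (p + 1 + 1).
  apply/funext => n; rewrite /pseries_diffs /= /GRing.scale/=.
  by rewrite mulrCA bincSl mulrA.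
have cZ k (c : nat -> R) : cvgn (pseries c K) -> cvgn (k \*: pseries c K).
  by move=> h; exact: is_cvgZl_tmp.
have := @pseries_snd_diffs R (binc p) K x.
rewrite E E2 !pseriesZ => H.
rewrite (_ : p * binser (p + 1) x = limn (p \*: pseries (binc (p + 1)) x)).
  by apply: H => //; [|apply: cZ|apply: cZ]; exact: is_cvg_binc.
by apply/esym/cvg_lim => //; apply: cvgZl_tmp; exact: is_cvg_binc.
Qed.

Lemma binserD1 (R : realType) (p x : R) : `|x| < 1 ->
  (1 - x) * binser (p + 1) x = binser p x.
Proof.
move=> x1; apply/esym/cvg_lim => //.
have c1 : cvgn (pseries (binc (p + 1)) x) by exact: is_cvg_binc.
have E n : pseries (binc p) x n.+1 =
    (1 - x) * pseries (binc (p + 1)) x n.+1 + x * (binc (p + 1) n * x ^+ n).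
  rewrite /pseries /series/=.
  elim: n => [|n IHn].
    by rewrite !big_nat1 !expr0 !mulr1 !binc0; ring.
  rewrite big_nat_recr//= IHn [in RHS]big_nat_recr//= -bincD1 !exprS.
  set S := \sum_(_ <= _ < _) _; ring.
rewrite -(cvg_shiftS (pseries (binc p) x)).
rewrite (_ : [sequence _]_n = (fun n => (1 - x) *
    pseries (binc (p + 1)) x n.+1 + x * (binc (p + 1) n * x ^+ n))); last first.
  exact/funext.
rewrite (_ : (1 - x) * _ = (1 - x) * binser (p + 1) x + x * 0); last first.
  by rewrite mulr0 addr0.
apply: cvgD; apply: cvgM; [exact: cvg_cst| |exact: cvg_cst|].
  by rewrite (cvg_shiftS (pseries (binc (p + 1)) x)).
exact: cvg_series_cvg_0 c1.
Qed.

Lemma binser0 (R : realType) (p : R) : binser p 0 = 1.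
Proof.
apply/cvg_lim => //; rewrite -cvg_shiftS.
apply: cvg_near_cst; apply: nearW => n.
rewrite /pseries /series/= big_nat_recl//= expr0 mulr1 binc0 big1 ?addr0//.
by move=> i _; rewrite exprS mul0r mulr0.
Qed.

(** The product of the series with (1 - x)^p has derivative zero, because [binserD1] converts the
    derivative p [binser (p + 1)] back to [binser p]. The product is therefore constant, with value
    1 at 0. *)
Lemma binserE (R : realType) (p x : R) : `|x| < 1 ->
  binser p x = (1 - x) `^ (- p).
Proof.
move=> x1.
pose h u : R := binser p u * (1 - u) `^ p.
have dh u : `|u| < 1 -> is_derive u (1 : R) h 0.
  move=> u1; have u10 : 0 < 1 - u by rewrite subr_gt0 (le_lt_trans (ler_norm u)).
  have D1 := is_derive_binser p u1.
  have D2 : is_derive u (1 : R) (fun v => (1 - v) `^ p)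
      (- (p * (1 - u) `^ (p - 1))).
    have Dp := is_derive1_powR p u10.
    have Do : is_derive u (1 : R) (fun v : R => 1 - v) (- 1).
      by apply: is_derive_eq; rewrite add0r mul1r.
    have := @is_derive1_comp _ (fun v => v `^ p) (fun v : R => 1 - v) u _ _ Dp Do.
    by rewrite mulrN1.
  have := is_deriveM D1 D2.
  rewrite (_ : _ + _ = 0)//.
  rewrite -(binserD1 p u1) /GRing.scale/=.
  have -> : (1 - u) `^ p = (1 - u) `^ (p - 1) * (1 - u).
    rewrite -[X in _ = _ * X](powRr1 (ltW u10)) -powRD ?subrK//.
    by rewrite (gt_eqF u10) implybT.
  by ring.
have ch u : `|u| < 1 -> {for u, continuous h}.
  move=> u1; apply: differentiable_continuous; apply/derivable1_diffP.
  by have [] := dh u u1.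
have hx : h x = h 0.
  have [x0|x0] := leP 0 x.
    have [||c _ /eqP] := @MVT_segment R h (fun=> 0) 0 x x0.
    - move=> u; rewrite in_itv/= => /andP[u0 ux]; apply: dh.
      by rewrite gtr0_norm// (lt_trans ux)// (le_lt_trans _ x1)// ler_norm.
    - apply: continuous_in_subspaceT => u; rewrite inE/= in_itv/= => /andP[u0 ux].
      apply: ch; rewrite ger0_norm// (le_lt_trans ux)//.
      by rewrite (le_lt_trans _ x1)// ler_norm.
    - by rewrite mul0r subr_eq0 => /eqP.
  have [||c _ /eqP] := @MVT_segment R h (fun=> 0) x 0 (ltW x0).
  - move=> u; rewrite in_itv/= => /andP[ux u0]; apply: dh.
    by rewrite ltr0_norm//; move: x1; rewrite ltr0_norm//; lra.
  - apply: continuous_in_subspaceT => u; rewrite inE/= in_itv/= => /andP[ux u0].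
    apply: ch; rewrite ler0_norm//; move: x1; rewrite ltr0_norm//; lra.
  - by rewrite mul0r subr_eq0 => /eqP.
move: hx; rewrite /h binser0 subr0 powR1 mulr1 => hx.
have p0 : (1 - x) `^ p != 0.
  by rewrite gt_eqF// powR_gt0// subr_gt0 (le_lt_trans (ler_norm x)).
by rewrite powRN -[LHS](mulfK p0) hx mul1r.
Qed.

Lemma cvg_binc (R : realType) (p x : R) : `|x| < 1 ->
  series (fun n => binc p n * x ^+ n) @ \oo --> (1 - x) `^ (- p).
Proof. by move=> x1; rewrite -binserE//; exact: is_cvg_binc. Qed.

(** * Termwise integration of dominated series *)

Section dominated_series.
Context (R : realType) (D : set R).
Hypothesis mD : measurable D.
Local Notation mu := (@lebesgue_measure R).
Implicit Types f g W u : R -> R.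

Lemma integrable_dominated f g : measurable_fun D f ->
  mu.-integrable D (EFin \o g) -> (forall t, D t -> `|f t| <= g t) ->
  mu.-integrable D (EFin \o f).
Proof.
move=> mf ig fg; apply: le_integrable ig => //.
  exact/measurable_EFinP.
by move=> t Dt /=; rewrite lee_fin (le_trans (fg t Dt))// ler_norm.
Qed.

Lemma dominated_cvg_Rintegral (f : nat -> R -> R) (F G : R -> R) :
  (forall n, measurable_fun D (f n)) ->
  mu.-integrable D (EFin \o G) ->
  (forall n t, D t -> `|f n t| <= G t) ->
  (forall t, D t -> f^~ t @ \oo --> F t) ->
  mu.-integrable D (EFin \o F) /\
  (fun n => \int[mu]_(t in D) f n t) @ \oo --> \int[mu]_(t in D) F t.
Proof.
move=> mf iG fG fF.
have mF : measurable_fun D F by exact: measurable_fun_cvg fF.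
have [] := @dominated_convergence _ _ R mu D mD (fun n => EFin \o f n)
  (EFin \o F) (EFin \o G).
- by move=> n; apply/measurable_EFinP; exact: mf.
- exact/measurable_EFinP.
- apply: aeW => t Dt; apply: cvg_EFin; first exact: nearW.
  exact: fF.
- exact: iG.
- by apply: aeW => t n Dt; rewrite /= lee_fin fG.
move=> iF _ cF; split => //.
rewrite /Rintegral; apply: fine_cvg.
by rewrite fineK//; exact: integrable_fin_num.
Qed.

Lemma series_dominated_Rintegral (f : nat -> R -> R) (F G : R -> R) :
  (forall n, measurable_fun D (f n)) ->
  mu.-integrable D (EFin \o G) ->
  (forall n t, D t -> `|\sum_(i < n) f i t| <= G t) ->
  (forall t, D t -> series (f^~ t) @ \oo --> F t) ->
  mu.-integrable D (EFin \o F) /\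
  series (fun n => \int[mu]_(t in D) f n t) @ \oo --> \int[mu]_(t in D) F t.
Proof.
move=> mf iG fG fF.
have mS n : measurable_fun D (fun t => \sum_(i < n) f i t).
  exact: measurable_sum.
have if_ n : mu.-integrable D (EFin \o f n).
  (* Only partial sums are assumed dominated; a term is the difference of two of them, hence the
     factor 2. *)
  apply: (@integrable_dominated _ (fun t => 2 * G t)) => //.
    rewrite (_ : _ \o _ = (fun t => 2%:E * (G t)%:E)%E)//.
    exact: integrableZl.
  move=> t Dt; have := fG n.+1 t Dt; rewrite big_ord_recr/=.
  by have := fG n t Dt; rewrite !ler_norml; lra.
have [iF cF] : mu.-integrable D (EFin \o F) /\
    (fun n => \int[mu]_(t in D) \sum_(i < n) f i t) @ \oo --> \int[mu]_(t in D) F t.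
  apply: (@dominated_cvg_Rintegral (fun n t => \sum_(i < n) f i t) F G) => //.
  move=> t Dt; rewrite (_ : (fun n => _) = series (f^~ t)); first exact: fF.
  by apply/funext => n; rewrite /series/= big_mkord.
split=> //; rewrite (_ : series _ =
    (fun n => \int[mu]_(t in D) \sum_(i < n) f i t))//.
apply/funext => n; rewrite /series/= big_mkord.
have sumE m : mu.-integrable D (EFin \o (fun t => \sum_(i < m) f i t)) /\
    \sum_(i < m) \int[mu]_(t in D) f i t = \int[mu]_(t in D) \sum_(i < m) f i t.
  elim: m => [|m [im IHm]].
    rewrite big_ord0; under eq_Rintegral do rewrite big_ord0.
    split; last by rewrite /Rintegral integral0.
    rewrite (_ : _ \o _ = cst 0%E); first exact: integrable0.
    by apply/funext => t /=; rewrite big_ord0.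
  rewrite (_ : (fun t => _) = (fun t => \sum_(i < m) f i t + f m t)); last first.
    by apply/funext => t; rewrite big_ord_recr.
  rewrite big_ord_recr/= IHm RintegralD//; split => //.
  by rewrite (_ : _ \o _ = ((EFin \o (fun t => \sum_(i < m) f i t)%R) \+
    (EFin \o f m))%E)//; exact: integrableD.
by have [] := sumE n.
Qed.

(** Since the binomial coefficients are nonnegative, every partial sum at [u] is bounded by the full
    sum at |u|, so the single integrable function W (1 - |u|)^(-p) dominates them all. *)
Lemma binomial_Rintegral (p : R) W u : 0 < p ->
  measurable_fun D W -> measurable_fun D u ->
  (forall t, D t -> 0 <= W t) -> (forall t, D t -> `|u t| < 1) ->
  mu.-integrable D (EFin \o (fun t => W t * (1 - `|u t|) `^ (- p))) ->
  mu.-integrable D (EFin \o (fun t => W t * (1 - u t) `^ (- p))) /\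
  series (fun n => binc p n * \int[mu]_(t in D) (W t * u t ^+ n)) @ \oo -->
    \int[mu]_(t in D) (W t * (1 - u t) `^ (- p)).
Proof.
move=> p0 mW mu_ W0 u1 iG.
pose f n t := binc p n * (W t * u t ^+ n).
have mWu n : measurable_fun D (fun t => W t * u t ^+ n).
  by apply: measurable_funM => //; exact: measurable_funX.
have W1 t : D t -> W t <= W t * (1 - `|u t|) `^ (- p).
  move=> Dt; rewrite ler_peMr ?W0// powRN invf_ge1.
    rewrite (le_trans (y := 1 `^ p))//; last by rewrite powR1.
    apply: ge0_ler_powR; rewrite ?nnegrE ?gerBl// ?ltW//.
    by rewrite subr_gt0 u1.
  by rewrite powR_gt0// subr_gt0 u1.
have iWu n : mu.-integrable D (EFin \o (fun t => W t * u t ^+ n)).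
  apply: (integrable_dominated (mWu n) iG) => t Dt.
  rewrite normrM normrX ger0_norm ?W0// (le_trans _ (W1 t Dt))//.
  by rewrite ler_piMr ?W0// exprn_ile1// ltW// u1.
rewrite (_ : (fun n => _) = (fun n => \int[mu]_(t in D) f n t)); last first.
  by apply/funext => n; rewrite RintegralZl.
apply: series_dominated_Rintegral iG _ _.
- by move=> n; apply: measurable_funM.
- move=> n t Dt.
  have -> : \sum_(i < n) f i t = W t * \sum_(i < n) binc p i * u t ^+ i.
    by rewrite mulr_sumr; apply: eq_bigr => i _; rewrite /f; ring.
  rewrite normrM ger0_norm ?W0// ler_wpM2l ?W0//.
  rewrite (le_trans (ler_norm_sum _ _ _))//.
  have c : series (fun n => binc p n * `|u t| ^+ n) @ \oo --> (1 - `|u t|) `^ (- p).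
    by apply: cvg_binc; rewrite normr_id u1.
  rewrite (le_trans (y := series (fun n => binc p n * `|u t| ^+ n) n))//.
    rewrite /series/= big_mkord; apply: ler_sum => i _.
    by rewrite normrM normrX ger0_norm// binc_ge0.
  rewrite -(cvg_lim _ c)//; apply: nondecreasing_cvgn_le; last exact/cvg_ex/ex_intro/c.
  apply: nondecreasing_series => i _ _.
  by rewrite mulr_ge0 ?binc_ge0// exprn_ge0.
- move=> t Dt; rewrite (_ : (fun n => f n t) = (fun n => W t * (binc p n * u t ^+ n))).
    rewrite (_ : series _ = (fun n => W t * series (fun n => binc p n * u t ^+ n) n)).
      apply: cvgM; first exact: cvg_cst.
      by apply: cvg_binc; rewrite u1.
    by apply/funext => n; rewrite /series/= mulr_sumr.
  by apply/funext => n; rewrite /f mulrCA.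
Qed.

End dominated_series.

(** * Abel's theorem *)

Lemma cvg_le_near (R : realType) (u : nat -> R) l M :
  u @ \oo --> l -> (\forall n \near \oo, u n <= M) -> l <= M.
Proof.
move=> ul uM; rewrite -(cvg_lim _ ul)//; apply: limr_le => //.
by apply/cvg_ex; exists l.
Qed.

(** Summation by parts centred at [s]: since (1 - r) times the sum of r^i for i < N, plus r^N, is 1,
    the constant distributes and only deviations of the partial sums from [s] remain. *)
Lemma abel_summation (R : realType) (a : nat -> R) (s r : R) N :
  \sum_(i < N.+1) a i * r ^+ i - s =
  (1 - r) * \sum_(i < N) (\sum_(j < i.+1) a j - s) * r ^+ i
    + (\sum_(j < N.+1) a j - s) * r ^+ N.
Proof.
elim: N => [|N IHN].
  by rewrite !big_ord_recr !big_ord0/= !expr0; ring.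
rewrite big_ord_recr/= addrAC IHN.
rewrite [\sum_(i < N.+1) (_ - s) * _]big_ord_recr/=.
rewrite [\sum_(j < N.+2) _]big_ord_recr/= !exprS.
by ring.
Qed.

(** Deviations before [N0] carry the factor 1 - r. Later ones are at most [e] against weights of
    total mass at most 1, and the boundary term of the summation by parts costs another [e]. *)
Lemma abel_bound (R : realType) (a : nat -> R) (s e l r : R) N0 :
  0 <= e -> 0 <= r < 1 -> (forall n, (N0 <= n)%N -> `|\sum_(j < n.+1) a j - s| <= e) ->
  series (fun n => a n * r ^+ n) @ \oo --> l ->
  `|l - s| <= (1 - r) * \sum_(i < N0) `|\sum_(j < i.+1) a j - s| + 2 * e.
Proof.
move=> e0 /andP[r0 r1] He cl.
set b := fun i : nat => \sum_(j < i.+1) a j - s.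
set B := \sum_(i < N0) `|_|.
have r1' : 0 <= 1 - r by rewrite subr_ge0 ltW.
have sB k : \sum_(i < N0 + k) `|b i| * r ^+ i <= B + e * \sum_(i < N0 + k) r ^+ i.
  elim: k => [|k IHk].
    rewrite addn0 -[leLHS]addr0 lerD ?mulr_ge0 ?sumr_ge0//; last first.
      by move=> i _; rewrite exprn_ge0.
    by apply: ler_sum => i _; rewrite ler_piMr// exprn_ile1// ltW.
  rewrite addnS !big_ord_recr/= mulrDr addrA lerD// ler_wpM2r ?exprn_ge0//.
  by apply: He; rewrite leq_addr.
have geo n : (1 - r) * \sum_(i < n) r ^+ i = 1 - r ^+ n.
  elim: n => [|n IHn]; first by rewrite big_ord0 expr0; ring.
  by rewrite big_ord_recr/= mulrDr IHn exprS; ring.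
have cl' : (fun n => `|series (fun n => a n * r ^+ n) n.+1 - s|) @ \oo --> `|l - s|.
  apply: cvg_norm; apply: cvgB; last exact: cvg_cst.
  by rewrite (cvg_shiftS (series (fun n => a n * r ^+ n))).
apply: (cvg_le_near cl'); exists N0 => // n /= N0n.
rewrite /series/= big_mkord abel_summation -/b.
have := sB (n - N0)%N; rewrite subnKC// => sBn.
rewrite (le_trans (ler_normD _ _))//.
have -> : 2 * e = e + e by ring.
rewrite addrA lerD//; last first.
  rewrite normrM normrX (ger0_norm r0) -[leRHS]mulr1.
  by rewrite ler_pM ?exprn_ge0// ?He// exprn_ile1// ltW.
rewrite normrM (ger0_norm r1').
rewrite (le_trans (y := (1 - r) * (B + e * \sum_(i < n) r ^+ i)))//.
  rewrite ler_wpM2l// (le_trans _ sBn)//.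
  rewrite (le_trans (ler_norm_sum _ _ _))//; apply: ler_sum => i _.
  by rewrite normrM normrX (ger0_norm r0).
rewrite mulrDr lerD2l mulrCA geo ler_piMr// gerBl.
by rewrite exprn_ge0.
Qed.

Lemma abel_limit (R : realType) (a A r : nat -> R) (s : R) :
  series a @ \oo --> s -> (forall m, 0 <= r m < 1) -> r @ \oo --> (1 : R) ->
  (forall m, series (fun n => a n * r m ^+ n) @ \oo --> A m) ->
  A @ \oo --> s.
Proof.
move=> cs r01 r1 cA; apply/cvgrPdist_le => e e0.
have e3 : 0 < e / 3 by rewrite divr_gt0.
have [N0 _ HN0] : \forall n \near \oo, `|s - series a n| <= e / 3.
  by move/cvgrPdist_le : cs; exact.
have He n : (N0 <= n)%N -> `|\sum_(j < n.+1) a j - s| <= e / 3.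
  move=> N0n; rewrite distrC; have := HN0 n.+1 (leq_trans N0n (leqnSn n)).
  by rewrite /= /series/= big_mkord.
set B := \sum_(i < N0) `|\sum_(j < i.+1) a j - s|.
have : (fun m => (1 - r m) * B) @ \oo --> 0.
  rewrite -(mul0r B); apply: cvgM; last exact: cvg_cst.
  by rewrite -(subrr 1); apply: cvgB => //; exact: cvg_cst.
move/cvgrPdist_le => /(_ _ e3) [M _ HM].
exists M => // m Mm /=; rewrite distrC.
have := abel_bound (ltW e3) (r01 m) He (cA m).
have := HM m Mm; rewrite /= sub0r normrN.
have := ler_norm ((1 - r m) * B); rewrite -/B; lra.
Qed.

(** * Complex power series *)

Local Notation normc := Normc.normc.

Lemma normrcE (R : realType) (z : R[i]) : `|z| = (normc z)%:C.
Proof. by []. Qed.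

Lemma normc_ge0 (R : realType) (z : R[i]) : 0 <= normc z.
Proof. by rewrite -lecR -normrcE normr_ge0. Qed.

Lemma normcD (R : realType) (x y : R[i]) : normc (x + y) <= normc x + normc y.
Proof. by rewrite -lecR rmorphD/= -!normrcE ler_normD. Qed.

Lemma normcB (R : realType) (x y : R[i]) : normc (x - y) <= normc x + normc y.
Proof. by rewrite -lecR rmorphD/= -!normrcE ler_normB. Qed.

Lemma normcX (R : realType) (z : R[i]) n : normc (z ^+ n) = normc z ^+ n.
Proof. by apply: complexI; rewrite rmorphXn/= -!normrcE normrX. Qed.

Lemma normc_real (R : realType) (x : R) : normc x%:C = `|x|.
Proof. by apply: complexI; rewrite -normrcE normc_def/= expr0n/= addr0 sqrtr_sqr. Qed.

Lemma normc_nat (R : realType) n : normc (n%:R : R[i]) = n%:R.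
Proof. by apply: complexI; rewrite -normrcE normr_nat rmorph_nat. Qed.

Lemma normc_sum (R : realType) (I : Type) (s : seq I) (P : pred I) (F : I -> R[i]) :
  normc (\sum_(i <- s | P i) F i) <= \sum_(i <- s | P i) normc (F i).
Proof.
by rewrite -lecR rmorph_sum/= -normrcE ler_norm_sum.
Qed.

Lemma normc_Re (R : realType) (z : R[i]) : `|complex.Re z| <= normc z.
Proof. by rewrite -lecR -normrcE normc_ge_Re. Qed.

Lemma normc_Im (R : realType) (z : R[i]) : `|complex.Im z| <= normc z.
Proof.
case: z => x y /=; rewrite -sqrtr_sqr; apply: ler_wsqrtr.
by rewrite lerDr sqr_ge0.
Qed.

Lemma normc_ReIm (R : realType) (z : R[i]) : normc z <= `|complex.Re z| + `|complex.Im z|.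
Proof.
rewrite {1}[z]complexE (le_trans (normcD _ _))//.
rewrite normc_real Normc.normcM normc_real.
rewrite (_ : normc 'i%C = 1) ?mul1r//.
by rewrite /= expr0n/= expr1n add0r sqrtr1.
Qed.

(** The order of [R[i]] compares only numbers with equal imaginary parts, so the epsilons of its
    norm topology are real. *)
Lemma ltc0P (R : realType) (e : R[i]) : 0 < e -> exists2 r : R, 0 < r & e = r%:C.
Proof.
case: e => r s; rewrite ltcE/= => /andP[/eqP -> r0].
by exists r.
Qed.

Lemma cvg_normcP (R : realType) (u : nat -> R[i]) (l : R[i]) :
  ((u : nat -> R[i]^o) @ \oo --> (l : R[i]^o)) <->
  ((fun n => normc (u n - l)) @ \oo --> (0 : R)).
Proof.
split.
  move=> /cvgrPdist_lt ul; apply/cvgrPdist_lt => e e0.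
  have /ul : 0 < e%:C by rewrite ltcR.
  apply: filterS => n; rewrite distrC normrcE ltcR sub0r normrN.
  by rewrite ger0_norm// normc_ge0.
move=> /cvgrPdist_lt ul; apply/cvgrPdist_lt => e /ltc0P[r r0 ->].
have := ul r r0.
apply: filterS => n; rewrite sub0r normrN ger0_norm ?normc_ge0//.
by rewrite distrC normrcE ltcR.
Qed.

Lemma cvg_real_complex (R : realType) (u : nat -> R) (l : R) :
  ((fun n => (u n)%:C : R[i]^o) @ \oo --> (l%:C : R[i]^o)) <-> (u @ \oo --> l).
Proof.
have E n : normc ((u n)%:C - l%:C) = `|u n - l|.
  by rewrite -normc_real rmorphB.
rewrite cvg_normcP; split=> /cvgrPdist_lt ul; apply/cvgrPdist_lt => e e0;
  by have := ul e e0; apply: filterS => n; rewrite E sub0r normrN normr_id distrC.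
Qed.

Lemma cvgc_unique (R : realType) (u : nat -> R[i]) (l m : R[i]) :
  (u : nat -> R[i]^o) @ \oo --> (l : R[i]^o) ->
  (u : nat -> R[i]^o) @ \oo --> (m : R[i]^o) -> l = m.
Proof. by move=> ul um; rewrite -(cvg_lim _ ul)// -(cvg_lim _ um). Qed.

Lemma cvg_normc (R : realType) (u : nat -> R[i]) (l : R[i]) :
  (u : nat -> R[i]^o) @ \oo --> (l : R[i]^o) ->
  (fun n => normc (u n)) @ \oo --> normc l.
Proof.
move=> /cvg_normcP /cvgrPdist_lt ul; apply/cvgrPdist_lt => e e0.
have := ul e e0; apply: filterS => n; rewrite sub0r normrN ger0_norm ?normc_ge0//.
apply: le_lt_trans; rewrite ler_norml.
have := normcB (u n) (u n - l); rewrite subKr.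
have := normcD (u n - l) l; rewrite subrK.
by lra.
Qed.

Lemma normc_series_cvg (R : realType) (a : nat -> R[i]) (M : R) :
  (forall N, \sum_(n < N) normc (a n) <= M) ->
  exists l : R[i], (series a : nat -> R[i]^o) @ \oo --> (l : R[i]^o).
Proof.
move=> aM.
have cn : cvgn (series (fun n => normc (a n))).
  apply: nondecreasing_is_cvgn.
    by apply: nondecreasing_series => n _ _; exact: normc_ge0.
  by exists M => _ [n _ <-]; rewrite /series/= big_mkord.
have c (f : R[i] -> R) : (forall z, `|f z| <= normc z) ->
    cvgn (series (fun n => f (a n))).
  move=> fn; apply: normed_cvg; apply: (series_le_cvg _ _ _ cn) => n.
  - exact: normr_ge0.
  - exact: normc_ge0.
  - exact: fn.
have /cvg_ex[/= x cx] := c (@complex.Re R) (@normc_Re R).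
have /cvg_ex[/= y cy] := c (@complex.Im R) (@normc_Im R).
exists (x +i* y); apply/cvg_normcP.
have cxy : (fun n => `|series (fun n => complex.Re (a n)) n - x| +
    `|series (fun n => complex.Im (a n)) n - y|) @ \oo --> (0 : R).
  rewrite -(addr0 0); apply: cvgD.
    by rewrite -(normr0 R) -(subrr x); apply: cvg_norm; apply: cvgB => //; exact: cvg_cst.
  by rewrite -(normr0 R) -(subrr y); apply: cvg_norm; apply: cvgB => //; exact: cvg_cst.
apply: (squeeze_cvgr _ (cvg_cst 0) cxy); apply: nearW => n.
rewrite normc_ge0/= (le_trans (normc_ReIm _))//.
by rewrite /series/= !raddfB/= !raddf_sum.
Qed.

(** The left-hand side is one term of the binomial expansion of the right-hand side. This trades the
    factor n for a slightly larger radius. *)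
Lemma deriv_pow_le (R : realType) (rho d : R) n : 0 <= rho -> 0 <= d ->
  n%:R * rho ^+ n.-1 * d <= (rho + d) ^+ n.
Proof.
move=> rho0 d0; elim: n => [|n IHn]; first by rewrite !mul0r expr0.
rewrite -pred_Sn exprS mulrDl.
have -> : n.+1%:R * rho ^+ n * d = rho * (n%:R * rho ^+ n.-1 * d) + d * rho ^+ n.
  case: n {IHn} => [|n]; first by rewrite expr0; ring.
  by rewrite exprS -[n.+2%:R]natr1 -pred_Sn; ring.
by rewrite lerD// ler_wpM2l// lerXn2r ?nnegrE ?addr_ge0// lerDl.
Qed.

(* Multiplying by [d ^+ 2] makes the bound geometric in [n]: the factor
   [n (n - 1) / 2] is absorbed in [(rho + d) ^+ n]. *)
Lemma taylor_pow_le (R : realType) (z h : R[i]) (rho d : R) n :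
  0 < d -> normc z <= rho -> normc (z + h) <= rho ->
  normc ((z + h) ^+ n - z ^+ n - n%:R * h * z ^+ n.-1) * d ^+ 2 <=
    normc h ^+ 2 * (rho + d) ^+ n.
Proof.
move=> d0 zr zhr; have rho0 : 0 <= rho by exact: le_trans (normc_ge0 z) zr.
elim: n => [|n IHn].
  rewrite !expr0 subrr sub0r !mul0r oppr0 Normc.normc0 mul0r.
  by rewrite mulr_ge0 ?exprn_ge0// ?addr_ge0 ?normc_ge0 ?ltW.
set E := (_ - _ - _) in IHn.
have -> : (z + h) ^+ n.+1 - z ^+ n.+1 - n.+1%:R * h * z ^+ n.+1.-1 =
    (z + h) * E + n%:R * h ^+ 2 * z ^+ n.-1.
  rewrite /E -pred_Sn; case: n {IHn E} => [|n]; first by rewrite !expr0 expr1; ring.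
  by rewrite -pred_Sn !exprS -[n.+2%:R]natr1; ring.
apply: (@le_trans _ _ (normc (z + h) * (normc E * d ^+ 2) +
    normc h ^+ 2 * d * (n%:R * normc z ^+ n.-1 * d))).
  rewrite [leRHS](_ : _ =
      (normc (z + h) * normc E + n%:R * normc h ^+ 2 * normc z ^+ n.-1) * d ^+ 2).
    rewrite ler_wpM2r ?exprn_ge0 ?(ltW d0)// (le_trans (normcD _ _))//.
    by rewrite !Normc.normcM !normcX normc_nat.
  by ring.
rewrite [(_ + d) ^+ n.+1]exprS mulrDl mulrDr lerD//.
  rewrite [leRHS]mulrCA; apply: ler_pM => //; first exact: normc_ge0.
  by rewrite mulr_ge0 ?normc_ge0// exprn_ge0// ltW.
rewrite -mulrA ler_wpM2l ?exprn_ge0 ?normc_ge0// ler_wpM2l ?(ltW d0)//.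
apply: le_trans (deriv_pow_le n rho0 (ltW d0)).
by rewrite ler_wpM2r ?(ltW d0)// ler_wpM2l// lerXn2r ?nnegrE ?normc_ge0.
Qed.

Lemma is_derive_complex (R : realType) (f : R[i] -> R[i]) (z l : R[i]) (C d : R) :
  0 < d -> 0 <= C ->
  (forall h, normc h <= d -> normc (f (h + z) - f z - h * l) <= C * normc h ^+ 2) ->
  @is_derive R[i] R[i]^o R[i]^o z 1 f l.
Proof.
move=> d0 C0 H.
suff hl : h^-1 *: ((f (h *: (1 : R[i]^o) + z) : R[i]^o) - f z)
    @[h --> (0 : R[i]^o)^'] --> (l : R[i]^o).
  split; first by apply/cvg_ex; exists l.
  exact: cvg_lim hl.
apply/cvgrPdist_lt => e /ltc0P[r r0 ->].
(* [C + 1] rather than [C], since [C] may be 0. *)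
pose s := Num.min d (r / (C + 1)).
have C1 : 0 < C + 1 by rewrite ltr_wpDl.
have s0 : 0 < s by rewrite lt_min d0 divr_gt0.
apply/nbhs_ballP; exists (s%:C); first by rewrite /= ltcR.
move=> h /=; rewrite -ball_normE/= sub0r normrN normrcE ltcR => hs h0.
have nh0 : 0 < normc h by rewrite -ltcR -normrcE normr_gt0.
rewrite distrC normrcE ltcR.
have -> : h^-1 *: ((f (h *: (1 : R[i]^o) + z) : R[i]^o) - f z) - l =
    h^-1 * (f (h + z) - f z - h * l).
  by rewrite /GRing.scale/= mulr1 [RHS]mulrBr mulKf.
rewrite Normc.normcM Normc.normcV ltr_pdivrMl//.
have hd : normc h <= d by rewrite ltW// (lt_le_trans hs)// ge_min lexx.
rewrite (le_lt_trans (H h hd))// [ltRHS]mulrC expr2 mulrA ltr_pM2r//.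
rewrite (@le_lt_trans _ _ ((C + 1) * normc h))//.
  by rewrite ler_wpM2r ?(ltW nh0)// lerDl.
by rewrite -ltr_pdivlMl// mulrC (lt_le_trans hs)// ge_min lexx orbT.
Qed.

(** By [taylor_pow_le] the first-order remainder of each monomial is quadratic in h with a factor
    geometric in n, so the remainders sum to at most (M / d^2) |h|^2, which is the bound
    [is_derive_complex] asks for. *)
Lemma power_series_derive (R : realType) (a : nat -> R[i]) (f : R[i] -> R[i])
    (r : R) (w z : R[i]) :
  (forall rho, 0 <= rho < r ->
    exists M, forall N, \sum_(n < N) normc (a n) * rho ^+ n <= M) ->
  (forall u, normc (u - w) < r ->
    series (fun n => a n * (u - w) ^+ n : R[i]^o) @ \oo --> (f u : R[i]^o)) ->
  normc (z - w) < r ->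
  exists2 l : R[i],
    series (fun n => n%:R * a n * (z - w) ^+ n.-1 : R[i]^o) @ \oo --> (l : R[i]^o) &
    @is_derive R[i] R[i]^o R[i]^o z 1 f l.
Proof.
(* A third of the gap, so that |z - w| + 2 d stays below [r]: one [d] is for the increment h, the
   other for absorbing the polynomial factors in n. *)
move=> Ha cf zr; set d := (r - normc (z - w)) / 3.
have d0 : 0 < d by rewrite divr_gt0// subr_gt0.
have zw0 := normc_ge0 (z - w).
pose rho := normc (z - w) + d.
have [|M HM] := Ha (rho + d); first by rewrite /rho /d; lra.
have [l cl] : exists l : R[i],
    series (fun n => n%:R * a n * (z - w) ^+ n.-1 : R[i]^o) @ \oo --> (l : R[i]^o).
  apply: (@normc_series_cvg _ _ (M / d)) => N.
  rewrite ler_pdivlMr// (le_trans _ (HM N))// mulr_suml; apply: ler_sum => n _.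
  rewrite !Normc.normcM normc_nat normcX -!mulrA mulrCA ler_wpM2l ?normc_ge0//.
  rewrite mulrA (le_trans (deriv_pow_le n zw0 (ltW d0)))//.
  by rewrite lerXn2r ?nnegrE// /rho; lra.
exists l; first exact: cl.
have M0 : 0 <= M by have := HM 0%N; rewrite big_ord0.
apply: (@is_derive_complex _ _ _ _ (M / d ^+ 2) d); first exact: d0.
  by rewrite divr_ge0// exprn_ge0// ltW.
move=> h hd.
have hzw : normc (h + z - w) <= rho.
  by rewrite -addrA addrC (le_trans (normcD _ _))// lerD2l.
have c : series (fun n => a n * (((z - w) + h) ^+ n - (z - w) ^+ n
    - n%:R * h * (z - w) ^+ n.-1) : R[i]^o) @ \oo -->
    (f (h + z) - f z - h * l : R[i]^o).
  rewrite (_ : series _ = (fun N =>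
    series (fun n => a n * (h + z - w) ^+ n : R[i]^o) N -
    series (fun n => a n * (z - w) ^+ n : R[i]^o) N -
    h * series (fun n => n%:R * a n * (z - w) ^+ n.-1 : R[i]^o) N : R[i]^o)).
    have ch : (fun N => h * series (fun n => n%:R * a n * (z - w) ^+ n.-1 : R[i]^o) N
        : R[i]^o) @ \oo --> (h * l : R[i]^o).
      by apply: cvgZl_tmp; exact: cl.
    apply: (@cvgB _ R[i]^o); last exact: ch.
    apply: (@cvgB _ R[i]^o); first by apply: cf; rewrite (le_lt_trans hzw)// /rho /d; lra.
    by apply: cf; rewrite (le_lt_trans _ zr).
  apply/funext => N; rewrite /series/= mulr_sumr -!sumrB; apply: eq_bigr => n _.
  by rewrite (_ : h + z - w = z - w + h); ring.
apply: (cvg_le_near (cvg_normc c)); apply: nearW => N.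
rewrite /series/= (le_trans (normc_sum _ _ _))//.
rewrite mulrAC ler_pdivlMr ?exprn_gt0// mulr_suml big_mkord.
rewrite (le_trans (y := \sum_(n < N) normc (a n) * (normc h ^+ 2 * (rho + d) ^+ n)))//.
  apply: ler_sum => n _; rewrite Normc.normcM -[leLHS]mulrA ler_wpM2l ?normc_ge0//.
  apply: taylor_pow_le => //; first by rewrite /rho lerDl ltW.
  by rewrite addrC addrA.
under eq_bigr do rewrite mulrCA.
by rewrite -mulr_sumr mulrC ler_wpM2r ?exprn_ge0 ?normc_ge0.
Qed.

(** * The value of 2F1 at -1 *)

Section euler_kernel.
Context (R : realType).
Local Notation mu := (@lebesgue_measure R).
Implicit Types (p q y s t : R).

Definition beta_weight q y t : R := t `^ (q - 1) * (1 - t) `^ (y - 1).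

Definition Beta q y : R := Gamma q * Gamma y / Gamma (q + y).

Lemma Beta_gt0 q y : 0 < q -> 0 < y -> 0 < Beta q y.
Proof.
by move=> q0 y0; rewrite divr_gt0 ?mulr_gt0 ?Gamma_gt0// addr_gt0.
Qed.

Lemma beta_weight_ge0 q y t : 0 <= beta_weight q y t.
Proof. by rewrite mulr_ge0 ?powR_ge0. Qed.

Lemma measurable_beta_weight q y D : measurable_fun D (beta_weight q y).
Proof.
apply: measurable_funTS; apply: measurable_funM; first exact: measurable_powR.
apply: (measurableT_comp (measurable_powR _)); exact: measurable_funB.
Qed.

Lemma integral_beta_weight q y : 0 < q -> 0 < y ->
  (\int[mu]_(t in `]0%R, 1%R[) (beta_weight q y t)%:E = (Beta q y)%:E)%E.
Proof. by move=> q0 y0; rewrite integral_beta_ker integral_beta_kerE. Qed.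

Lemma Rintegral_beta_weight q y : 0 < q -> 0 < y ->
  \int[mu]_(t in `]0, 1[) beta_weight q y t = Beta q y.
Proof. by move=> q0 y0; rewrite /Rintegral integral_beta_weight. Qed.

Lemma integrable_beta_weight q y : 0 < q -> 0 < y ->
  mu.-integrable `]0, 1[ (EFin \o beta_weight q y).
Proof.
move=> q0 y0; apply/integrableP; split.
  by apply/measurable_EFinP; exact: measurable_beta_weight.
under eq_integral do rewrite /= ger0_norm ?beta_weight_ge0//.
by rewrite integral_beta_weight// ltry.
Qed.

Lemma integrable_beta_weightM q y (f : R -> R) (C : R) : 0 < q -> 0 < y ->
  measurable_fun (`]0%R, 1%R[%classic : set R) f -> (forall t, 0 < t < 1 -> `|f t| <= C) ->
  mu.-integrable `]0, 1[ (EFin \o (fun t => beta_weight q y t * f t)).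
Proof.
move=> q0 y0 mf fC.
apply: (@integrable_dominated _ _ _ _ (fun t => C * beta_weight q y t)).
- by [].
- apply: measurable_funM => //; exact: measurable_beta_weight.
- rewrite (_ : _ \o _ = (fun t => C%:E * (beta_weight q y t)%:E)%E)//.
  by apply: integrableZl => //; exact: integrable_beta_weight.
- move=> t; rewrite /= in_itv/= => t01.
  rewrite normrM ger0_norm ?beta_weight_ge0// mulrC.
  by rewrite ler_wpM2r ?beta_weight_ge0// fC.
Qed.

Lemma beta_weightX q y n t : 0 < t ->
  beta_weight q y t * t ^+ n = beta_weight (q + n%:R) y t.
Proof.
move=> t0; rewrite /beta_weight mulrAC -powR_mulrn ?ltW// -powRD.
  by congr (_ `^ _ * _); ring.
by rewrite (gt_eqF t0) implybT.
Qed.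

Lemma powRN_le p (m x : R) : 0 < p -> 0 < m -> m <= x -> x `^ (- p) <= m `^ (- p).
Proof.
move=> p0 m0 mx; have x0 : 0 < x by exact: lt_le_trans mx.
rewrite !powRN lef_pV2 ?posrE ?powR_gt0//.
by apply: ge0_ler_powR; rewrite ?nnegrE ?(ltW p0) ?(ltW m0) ?(ltW x0).
Qed.

Lemma measurable_powR_affine p (a b : R) D :
  measurable_fun D (fun t : R => (a + b * t) `^ p).
Proof.
apply: measurable_funTS; apply: (measurableT_comp (measurable_powR _)).
by apply: measurable_funD => //; exact: measurable_funM.
Qed.

End euler_kernel.

Section recentring.
Context (R : realType) (p q y : R).
Hypotheses (p0 : 0 < p) (q0 : 0 < q) (y0 : 0 < y).
Local Notation mu := (@lebesgue_measure R).
Local Notation D := (`]0%R, 1%R[%classic : set R).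
Implicit Types s t : R.

(** Chosen so that 1 + t/2 - t s = (1 + t/2) (1 - s v(t)). On ]0, 1[ one has 0 < v < 2/3, whence the
    radius 3/2. *)
Let W t : R := beta_weight q y t * (1 + 2^-1 * t) `^ (- p).
Let v t : R := t / (1 + 2^-1 * t).

(* Coefficients of the Euler integral of [2F1 (p, q; q + y; .)] expanded in
   powers of [z + 1/2]; the expansion has radius of convergence 3/2. *)
Definition euler_coef (k : nat) : R :=
  (Beta q y)^-1 * (binc p k * \int[mu]_(t in D) (W t * v t ^+ k)).

(* Value of that Euler integral at [z = s - 1/2]. *)
Definition euler_kernel s : R :=
  (Beta q y)^-1 * \int[mu]_(t in D) (beta_weight q y t * (1 + 2^-1 * t - t * s) `^ (- p)).

(* Coefficients of the same function in powers of [z]. *)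
Definition hyp_coef (j : nat) : R := binc p j * (poch q j / poch (q + y) j).

Let mD : measurable D. Proof. exact: measurable_itv. Qed.

Let mv : measurable_fun D v.
Proof.
apply: (@eq_measurable_fun _ _ _ _ _ (fun t => t * (1 + 2^-1 * t) `^ (- 1))).
  move=> t /set_mem; rewrite /= in_itv/= => /andP[t0 t1].
  by rewrite powR_inv1// addr_ge0// mulr_ge0// ltW.
apply: measurable_funM => //; exact: measurable_powR_affine.
Qed.

Let mW : measurable_fun D W.
Proof.
by apply: measurable_funM; [exact: measurable_beta_weight|exact: measurable_powR_affine].
Qed.

Let W0 t : 0 <= W t.
Proof. by rewrite mulr_ge0 ?beta_weight_ge0// powR_ge0. Qed.

Let v0 t : D t -> 0 <= v t.
Proof.
rewrite /= in_itv/= => /andP[t0 t1].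
by rewrite divr_ge0 ?addr_ge0 ?mulr_ge0// ltW.
Qed.

Lemma euler_coef_ge0 k : 0 <= euler_coef k.
Proof.
rewrite /euler_coef mulr_ge0//; first by rewrite invr_ge0 ltW// Beta_gt0.
rewrite mulr_ge0 ?binc_ge0//; apply: Rintegral_ge0 => t Dt.
by rewrite mulr_ge0// exprn_ge0// v0.
Qed.

Let D_inv t : D t -> 0 < 1 + 2^-1 * t.
Proof. by rewrite /= in_itv/= => /andP[t0 t1]; rewrite addr_gt0// mulr_gt0. Qed.

Let iWv k : mu.-integrable D (EFin \o (fun t => W t * v t ^+ k)).
Proof.
rewrite (_ : (fun t => _) = (fun t => beta_weight q y t *
    ((1 + 2^-1 * t) `^ (- p) * v t ^+ k))); last first.
  by apply/funext => t; rewrite mulrA.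
apply: (@integrable_beta_weightM _ _ _ _ 1) => //.
  by apply: measurable_funM; [exact: measurable_powR_affine|exact: measurable_funX].
move=> t t01; have Dt : D t by rewrite /= in_itv.
rewrite ger0_norm; last by rewrite mulr_ge0 ?powR_ge0// exprn_ge0// v0.
case/andP: t01 => t0 t1.
rewrite mulr_ile1 ?powR_ge0 ?exprn_ge0 ?v0//.
  rewrite (le_trans (y := 1 `^ (- p)))//; last by rewrite powR1.
  by apply: powRN_le => //; rewrite lerDl mulr_ge0// ltW.
rewrite exprn_ile1 ?v0// ler_pdivrMr ?D_inv// mul1r; lra.
Qed.

Lemma cvg_euler_coef s : `|s| < 3 / 2 ->
  series (fun k => euler_coef k * s ^+ k) @ \oo --> euler_kernel s.
Proof.
move=> s32.
have E0 t : D t -> 1 + 2^-1 * t != 0 by move=> Dt; rewrite gt_eqF// D_inv.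
have u1 t : D t -> `|s| * t < 1 + 2^-1 * t.
  rewrite /= in_itv/= => /andP[t0 t1].
  have : `|s| * t < 3 / 2 * t by rewrite ltr_pM2r.
  lra.
have nu t : D t -> `|s * v t| = `|s| * t / (1 + 2^-1 * t).
  by move=> Dt; rewrite normrM (ger0_norm (v0 Dt)) mulrA.
have WE (r : R) t : D t -> 0 <= 1 - r * v t ->
    W t * (1 - r * v t) `^ (- p) = beta_weight q y t * (1 + 2^-1 * t - t * r) `^ (- p).
  move=> Dt h; rewrite -mulrA -powRM ?(ltW (D_inv Dt))//; congr (_ * _ `^ _).
  rewrite /v; move: (E0 t Dt); move: (1 + 2^-1 * t) => e e0.
  by field.
have nu1 t : D t -> `|s * v t| < 1.
  by move=> Dt; rewrite nu// ltr_pdivrMr ?D_inv// mul1r u1.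
have [||||||_] := @binomial_Rintegral R D _ p W (fun t => s * v t) p0 => //.
- by apply: measurable_funM.
(* Lower bound of the affine function 1 + (1/2 - |s|) t on ]0, 1[: its values at the ends are 1 and
   3/2 - |s|. *)
- pose m := Num.min 1 (3 / 2 - `|s|).
  have m0 : 0 < m by rewrite lt_min ltr01 subr_gt0.
  have E1 : mu.-integrable D (EFin \o (fun t =>
      beta_weight q y t * (1 + (2^-1 - `|s|) * t) `^ (- p))).
    apply: (@integrable_beta_weightM _ _ _ _ (m `^ (- p))) => //.
      exact: measurable_powR_affine.
    move=> t /andP[t0 t1]; rewrite ger0_norm ?powR_ge0//; apply: powRN_le => //.
    rewrite ge_min; have [h|h] := leP `|s| 2^-1; apply/orP.
      by left; rewrite lerDl mulr_ge0// ?subr_ge0// ltW.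
    by right; nra.
  apply: eq_integrable E1 => // t /set_mem Dt /=; congr EFin.
  rewrite normrM (ger0_norm (v0 Dt)) WE//.
    by congr (_ * _ `^ _); ring.
  by rewrite -{1}(ger0_norm (v0 Dt)) -normrM subr_ge0 ltW// nu1.
move=> c; rewrite /euler_kernel.
rewrite (_ : \int[mu]_(t in D) _ = \int[mu]_(t in D) (W t * (1 - s * v t) `^ (- p))).
  rewrite (_ : series _ = (fun n => (Beta q y)^-1 * series (fun n =>
     binc p n * \int[mu]_(t in D) (W t * (s * v t) ^+ n)) n)).
    by apply: cvgMl_tmp; exact: c.
  apply/funext => n; rewrite /series/= mulr_sumr; apply: eq_bigr => k _.
  have -> : \int[mu]_(t in D) (W t * (s * v t) ^+ k) =
      s ^+ k * \int[mu]_(t in D) (W t * v t ^+ k).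
    rewrite -RintegralZl//.
    by apply: eq_Rintegral => t _; rewrite exprMn mulrCA.
  by rewrite /euler_coef; ring.
apply: eq_Rintegral => t /set_mem Dt; rewrite WE//.
by rewrite subr_ge0 (le_trans (ler_norm _))// ltW// nu1.
Qed.

(** Euler's integral coefficient by coefficient: Beta(q + j, y) / Beta(q, y) is (q)_j / (q +
    y)_j. *)
Lemma hyp_coefE j :
  hyp_coef j = (Beta q y)^-1 * (binc p j * \int[mu]_(t in D) (beta_weight q y t * t ^+ j)).
Proof.
have -> : \int[mu]_(t in D) (beta_weight q y t * t ^+ j) =
    \int[mu]_(t in D) beta_weight (q + j%:R) y t.
  apply: eq_Rintegral => t /set_mem; rewrite /= in_itv/= => /andP[t0 t1].
  by rewrite beta_weightX.
rewrite Rintegral_beta_weight ?ltr_wpDr// /Beta (addrAC q _ y) !GammaDn ?addr_gt0//.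
rewrite /hyp_coef.
have g1 := lt0r_neq0 (Gamma_gt0 q0); have g2 := lt0r_neq0 (Gamma_gt0 y0).
have g3 := lt0r_neq0 (Gamma_gt0 (addr_gt0 q0 y0)).
have g4 := lt0r_neq0 (poch_gt0 j (addr_gt0 q0 y0)).
move: g1 g2 g3 g4; move: (Gamma q) (Gamma y) (Gamma (q + y)) (poch (q + y) j).
move: (poch q j) (binc p j) => x1 x2 x3 x4 x5 x6 g1 g2 g3 g4.
by field; rewrite ?g1 ?g2 ?g3 ?g4.
Qed.

Let iw j : mu.-integrable D (EFin \o (fun t => beta_weight q y t * t ^+ j)).
Proof.
apply: (@integrable_beta_weightM _ _ _ _ 1) => //.
move=> t /andP[t0 t1]; rewrite normrX exprn_ile1// ger0_norm// ltW//.
Qed.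

(** [euler_kernel] takes the displacement from -1/2, so its argument 1/2 + r stands for the point r,
    where the integrand contains (1 - r t)^(-p). *)
Lemma cvg_hyp_coef r : `|r| < 1 ->
  series (fun j => hyp_coef j * r ^+ j) @ \oo --> euler_kernel (2^-1 + r).
Proof.
move=> r1.
have rt t : D t -> `|r * t| <= `|r|.
  rewrite /= in_itv/= => /andP[t0 t1].
  by rewrite normrM ler_piMr// ger0_norm// ltW.
have [||||||_] := @binomial_Rintegral R D _ p (beta_weight q y) (fun t => r * t) p0 => //.
- exact: measurable_beta_weight.
- exact: measurable_funM.
- by move=> t _; exact: beta_weight_ge0.
- by move=> t Dt; rewrite (le_lt_trans (rt t Dt)).
- have E1 : mu.-integrable D (EFin \o (fun t =>
      beta_weight q y t * (1 + (- `|r|) * t) `^ (- p))).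
    apply: (@integrable_beta_weightM _ _ _ _ ((1 - `|r|) `^ (- p))) => //.
      exact: measurable_powR_affine.
    move=> t t01; rewrite ger0_norm ?powR_ge0//; apply: powRN_le => //.
      by rewrite subr_gt0.
    have Dt : D t by rewrite /= in_itv.
    have := rt t Dt; rewrite normrM (gtr0_norm (andP t01).1); lra.
  apply: eq_integrable E1 => // t /set_mem; rewrite /= in_itv/= => /andP[t0 t1].
  by rewrite normrM (gtr0_norm t0) mulNr.
move=> c; rewrite /euler_kernel.
rewrite (_ : \int[mu]_(t in D) _ =
    \int[mu]_(t in D) (beta_weight q y t * (1 - r * t) `^ (- p))); last first.
  by apply: eq_Rintegral => t _; congr (_ * _ `^ _); ring.
rewrite (_ : series _ = (fun n => (Beta q y)^-1 * series (fun n =>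
   binc p n * \int[mu]_(t in D) (beta_weight q y t * (r * t) ^+ n)) n)).
  by apply: cvgMl_tmp; exact: c.
apply/funext => n; rewrite /series/= mulr_sumr; apply: eq_bigr => k _.
have -> : \int[mu]_(t in D) (beta_weight q y t * (r * t) ^+ k) =
    r ^+ k * \int[mu]_(t in D) (beta_weight q y t * t ^+ k).
  rewrite -RintegralZl//.
  by apply: eq_Rintegral => t _; rewrite exprMn mulrCA.
by rewrite hyp_coefE; ring.
Qed.

Lemma binc_bin j m : binc p (j + m) * 'C(j + m, j)%:R = binc p j * binc (p + j%:R) m.
Proof.
have E : poch p (j + m) = poch p j * poch (p + j%:R) m.
  rewrite /poch big_split_ord/=; congr (_ * _); apply: eq_bigr => i _.
  by rewrite natrD addrA.
have := bin_fact (leq_addr m j); rewrite addKn => /(congr1 (fun n => n%:R : R)).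
rewrite !natrM /binc E => <-.
have f0 n : n`!%:R != 0 :> R by rewrite pnatr_eq0 -lt0n fact_gt0.
have c0 : 'C(j + m, j)%:R != 0 :> R by rewrite pnatr_eq0 -lt0n bin_gt0 leq_addr.
have := f0 j; have := f0 m; move: c0.
move: 'C(j + m, j)%:R j`!%:R m`!%:R (poch p j) (poch _ m) => c f g x z c0 g0 f1.
by field; rewrite ?f1 ?g0 ?c0.
Qed.

(* The left-hand side is a partial sum of a nonnegative series with sum
   [hyp_coef j], obtained by re-expanding at 0. *)
Lemma euler_coef_bin_le N j :
  \sum_(k < N) euler_coef k * 2^-1 ^+ (k - j) * 'C(k, j)%:R <= hyp_coef j.
Proof.
have vj t : D t -> `|2^-1 * v t| < 1.
  move=> Dt; rewrite ger0_norm; last by rewrite mulr_ge0// v0.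
  rewrite /v mulrA ltr_pdivrMr ?D_inv// mul1r.
  by rewrite ltrDr.
have pj : 0 < p + j%:R by rewrite ltr_wpDr.
have WE t : D t -> W t * v t ^+ j * (1 - 2^-1 * v t) `^ (- (p + j%:R)) =
    beta_weight q y t * t ^+ j.
  move=> Dt; have e0 := D_inv Dt.
  have t0 : 0 < t by move: Dt; rewrite /= in_itv/= => /andP[].
  (* The origin is the displacement 1/2 from the centre. There this reciprocal cancels the
     denominators of [W] and of [v ^+ j], leaving the integrand of [hyp_coef j]. *)
  have -> : 1 - 2^-1 * v t = (1 + 2^-1 * t)^-1.
    rewrite /v; move: e0; rewrite /is_true => e0.
    have : 1 + 2^-1 * t != 0 by rewrite gt_eqF.
    have -> : t = 2 * ((1 + 2^-1 * t) - 1) by field.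
    have -> : 1 + 2^-1 * (2 * (1 + 2^-1 * t - 1)) = 1 + 2^-1 * t by field.
    by move: (1 + 2^-1 * t) => e e1; field.
  rewrite -powR_inv1 ?ltW// -powRrM mulN1r opprK powRD; last first.
    by rewrite (gt_eqF e0) implybT.
  rewrite powR_mulrn ?ltW// /W /v expr_div_n powRN.
  have := lt0r_neq0 (powR_gt0 p e0); have : (1 + 2^-1 * t) ^+ j != 0.
    by rewrite expf_neq0// gt_eqF.
  move: ((1 + 2^-1 * t) `^ p) ((1 + 2^-1 * t) ^+ j) (t ^+ j) (beta_weight _ _ _).
  by move=> e1 e2 e3 e4 h1 h2; field; rewrite h1 h2.
have [||||||_] := @binomial_Rintegral R D _ (p + j%:R) (fun t => W t * v t ^+ j)
   (fun t => 2^-1 * v t) pj => //.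
- by apply: measurable_funM => //; exact: measurable_funX.
- by apply: measurable_funM.
- by move=> t Dt; rewrite mulr_ge0// exprn_ge0// v0.
- apply: eq_integrable (iw j) => // t /set_mem Dt; rewrite /= ger0_norm ?WE//.
  by rewrite mulr_ge0// v0.
have -> : \int[mu]_(t in D) (W t * v t ^+ j * (1 - 2^-1 * v t) `^ (- (p + j%:R))) =
    \int[mu]_(t in D) (beta_weight q y t * t ^+ j).
  by apply: eq_Rintegral => t /set_mem Dt; exact: WE.
set I := \int[mu]_(t in D) _; set T := series _ => c.
have I0 k : 0 <= \int[mu]_(t in D) (W t * v t ^+ k).
  by apply: Rintegral_ge0 => t Dt; rewrite mulr_ge0// exprn_ge0// v0.
have TE m : T m = \sum_(k < m) binc (p + j%:R) k * (2^-1 ^+ k *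
    \int[mu]_(t in D) (W t * v t ^+ (j + k))).
  rewrite /T /series/= big_mkord; apply: eq_bigr => k _; congr (_ * _).
  rewrite -RintegralZl//; apply: eq_Rintegral => t _.
  by move: (W t) (v t) (2^-1 : R) => x z h; rewrite exprMn exprD; ring.
have Tle m : T m <= I.
  rewrite -(cvg_lim _ c)//; apply: nondecreasing_cvgn_le; last by apply/cvg_ex; exists I.
  apply/nondecreasing_seqP => n; rewrite !TE big_ord_recr/= lerDl.
  by rewrite mulr_ge0 ?binc_ge0// mulr_ge0// exprn_ge0.
(* Enlarging the range by j costs nothing, as the terms are nonnegative. The terms with k < j vanish
   with their binomial coefficient, so exactly N terms indexed by k - j remain. *)
apply: (@le_trans _ _ (\sum_(k < N + j) euler_coef k * 2^-1 ^+ (k - j) * 'C(k, j)%:R)).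
  rewrite big_split_ord/= lerDl sumr_ge0// => k _.
  apply: mulr_ge0; last exact: ler0n.
  by apply: mulr_ge0; [exact: euler_coef_ge0|exact: exprn_ge0].
rewrite addnC big_split_ord/= big1 ?add0r; last first.
  by move=> k _; rewrite bin_small// mulr0.
rewrite hyp_coefE mulrA.
apply: le_trans (_ : (Beta q y)^-1 * binc p j * T N <= _); last first.
  apply: ler_wpM2l; last exact: Tle.
  by rewrite mulr_ge0 ?binc_ge0// invr_ge0 ltW// Beta_gt0.
rewrite TE mulr_sumr; apply: ler_sum => k _.
rewrite addKn /euler_coef.
rewrite (_ : _ * 'C(_, _)%:R = (Beta q y)^-1 * (binc p (j + k) * 'C(j + k, j)%:R) *
  (2^-1 ^+ k * \int[mu]_(t in D) (W t * v t ^+ (j + k)))); last by ring.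
by rewrite binc_bin le_eqVlt; apply/orP; left; apply/eqP; ring.
Qed.

End recentring.

Lemma series_ge0_le (R : realType) (a : nat -> R) l : (forall n, 0 <= a n) ->
  series a @ \oo --> l -> forall N, \sum_(n < N) a n <= l.
Proof.
move=> a0 c N; rewrite -(big_mkord xpredT) -/(series a N) -(cvg_lim _ c)//.
apply: nondecreasing_cvgn_le; last by apply/cvg_ex; exists l.
by apply: nondecreasing_series => n _ _.
Qed.

Lemma poch_real (R : realType) (x : R) n : poch x%:C n = (poch x n)%:C.
Proof.
rewrite /poch rmorph_prod; apply: eq_bigr => i _.
by rewrite rmorphD rmorph_nat.
Qed.

Lemma poch1 (K : nzRingType) n : poch (1 : K) n = n`!%:R.
Proof.
elim: n => [|n IHn]; first by rewrite poch0 fact0.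
by rewrite pochS IHn factS nat1r mulnC natrM.
Qed.

(** Only finite sums are rearranged, by the binomial theorem. The inner sum may run over all k < N
    because 'C(k, j) vanishes for k < j. *)
Lemma sum_recentre (K : comNzRingType) (c : nat -> K) (x h : K) N :
  \sum_(k < N) c k * (x + h) ^+ k =
  \sum_(j < N) (\sum_(k < N) c k * h ^+ (k - j) * 'C(k, j)%:R) * x ^+ j.
Proof.
under [RHS]eq_bigr do rewrite mulr_suml.
rewrite [RHS]exchange_big/=; apply: eq_bigr => k _.
rewrite addrC exprDn mulr_sumr.
rewrite (big_ord_widen N (fun i => c k * (h ^+ (k - i) * x ^+ i *+ 'C(k, i))))//.
rewrite big_mkcond/=; apply: eq_bigr => i _.
rewrite -mulr_natr; case: ifPn => [_|]; first by ring.
by rewrite -ltnNge => ki; rewrite bin_small// mulr0 mul0r.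
Qed.

Lemma real_complex_mulX (R : realType) (a b : R) n :
  (a * b ^+ n)%:C = a%:C * b%:C ^+ n.
Proof. by rewrite rmorphM rmorphXn. Qed.

Lemma discE (R : realType) (z : R[i]) : disc z = (normc z < 1) :> Prop.
Proof.
by rewrite /disc/= normrcE (_ : 1 = (1 : R)%:C :> R[i]) ?ltcR// rmorph1.
Qed.

Section hyp2F1_at_m1.
Context (R : realType) (p q y : R).
Hypotheses (p0 : 0 < p) (q0 : 0 < q) (y0 : 0 < y).

Let c := euler_coef p q y.
Let g := hyp_coef p q y.
Let w : R[i] := (- 2^-1)%:C.

Let c0 n : 0 <= c n. Proof. exact: euler_coef_ge0. Qed.

Let F (z : R[i]) : R[i] := limn (series (fun k => (c k)%:C * (z - w) ^+ k : R[i]^o)).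

Let bound rho : 0 <= rho < 3 / 2 ->
  exists M, forall N, \sum_(n < N) normc (c n)%:C * rho ^+ n <= M.
Proof.
move=> /andP[r0 r1]; exists (euler_kernel p q y rho) => N.
under eq_bigr do rewrite normc_real ger0_norm//.
apply: (@series_ge0_le _ (fun n => c n * rho ^+ n)).
  by move=> n; rewrite mulr_ge0// exprn_ge0.
by apply: cvg_euler_coef => //; rewrite ger0_norm.
Qed.

Let Fcvg u : normc (u - w) < 3 / 2 ->
  series (fun k => (c k)%:C * (u - w) ^+ k : R[i]^o) @ \oo --> (F u : R[i]^o).
Proof.
move=> uw; have [|M HM] := @bound (normc (u - w)); first by rewrite normc_ge0.
have HN N : \sum_(n < N) normc ((c n)%:C * (u - w) ^+ n) <= M.
  apply: le_trans (HM N); apply: ler_sum => n _.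
  by rewrite Normc.normcM normcX.
have [l cl] := @normc_series_cvg R (fun k => (c k)%:C * (u - w) ^+ k) M HN.
by rewrite /F (cvg_lim _ cl).
Qed.

Let Fm1 : F (-1) = (euler_kernel p q y (- 2^-1))%:C.
Proof.
have E : -1 - w = (- 2^-1)%:C.
  have -> : -1 = (-1)%:C :> R[i] by rewrite rmorphN rmorph1.
  by rewrite /w -rmorphB/=; congr (_%:C); field.
have c1 := @Fcvg (-1); rewrite E normc_real in c1.
have h : `|- 2^-1 : R| < 3 / 2 by rewrite normrN ger0_norm//; lra.
apply: (cvgc_unique (c1 h)).
rewrite (_ : series _ = (fun n => (series (fun k => c k * (- 2^-1) ^+ k) n)%:C)).
  by apply/cvg_real_complex; exact: cvg_euler_coef.
apply/funext => n; rewrite /series/= rmorph_sum; apply: eq_bigr => k _.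
by rewrite /= real_complex_mulX.
Qed.

(* As [euler_coef_bin_le] holds coefficientwise, the difference of the partial
   sums at [u] is dominated by the real one at [normc u], which tends to 0. *)
Let Fdisc u : normc u < 1 ->
  series (fun j => (g j)%:C * u ^+ j : R[i]^o) @ \oo --> (F u : R[i]^o).
Proof.
move=> u1; set rho := normc u.
have r0 : 0 <= rho by exact: normc_ge0.
have uw : normc (u - w) < 3 / 2.
  rewrite (le_lt_trans (normcB _ _))// normc_real normrN ger0_norm//.
  by rewrite -/rho; have : rho < 1 := u1; lra.
have cK : series (fun k => c k * (rho + 2^-1) ^+ k) @ \oo -->
    euler_kernel p q y (2^-1 + rho).
  rewrite [2^-1 + rho]addrC; apply: cvg_euler_coef => //.
  by rewrite ger0_norm ?addr_ge0//; have : rho < 1 := u1; lra.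
have cg : series (fun j => g j * rho ^+ j) @ \oo --> euler_kernel p q y (2^-1 + rho).
  by apply: cvg_hyp_coef => //; rewrite ger0_norm.
have cd : (fun N => series (fun j => g j * rho ^+ j) N -
    series (fun k => c k * (rho + 2^-1) ^+ k) N) @ \oo --> (0 : R).
  by rewrite -(subrr (euler_kernel p q y (2^-1 + rho))); exact: cvgB.
have FE := Fcvg uw.
suff D0 : (fun N => series (fun j => (g j)%:C * u ^+ j) N -
   series (fun k => (c k)%:C * (u - w) ^+ k) N : R[i]^o) @ \oo --> (0 : R[i]^o).
  rewrite (_ : series _ = (fun N => (series (fun j => (g j)%:C * u ^+ j) N -
    series (fun k => (c k)%:C * (u - w) ^+ k) N) +
    series (fun k => (c k)%:C * (u - w) ^+ k) N : R[i]^o)).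
    by rewrite -[F u]add0r; exact: (@cvgD _ R[i]^o _ _ _ _ _ _ _ D0 FE).
  by apply/funext => N; rewrite subrK.
apply/cvg_normcP.
apply: (squeeze_cvgr _ (cvg_cst 0) cd); apply: nearW => N.
rewrite normc_ge0 subr0 /series/= !big_mkord/=.
have -> : u - w = u + (2^-1)%:C by rewrite /w rmorphN opprK.
rewrite (sum_recentre (fun k => (c k)%:C) u) (sum_recentre c rho) -!sumrB.
rewrite (le_trans (normc_sum _ _ _))//.
apply: ler_sum => j _; rewrite -!mulrBl Normc.normcM normcX ler_wpM2r ?exprn_ge0//.
rewrite (_ : _ - _ = (g j - \sum_(k < N) c k * 2^-1 ^+ (k - j) * 'C(k, j)%:R)%:C).
  by rewrite normc_real ger0_norm// subr_ge0 euler_coef_bin_le.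
rewrite rmorphB rmorph_sum; congr (_ - _); apply: eq_bigr => k _.
by rewrite [RHS]rmorphM/= rmorph_nat real_complex_mulX.
Qed.

Let hypE u : normc u < 1 ->
  hypergeom [:: p%:C; q%:C] [:: (q + y)%:C] u = F u.
Proof.
move=> u1; rewrite /hypergeom -(cvg_lim _ (Fdisc u1))//.
set a := (fun n : nat => _); set b := (fun j : nat => _).
suff -> : a = b by [].
apply/funext => n; rewrite /a /b.
rewrite !big_cons !big_nil !mulr1 !poch_real poch1.
rewrite -!rmorphM -fmorphV -rmorphM/=; congr (_%:C * _).
rewrite /g /hyp_coef /binc.
have f0 : n`!%:R != 0 :> R by rewrite pnatr_eq0 -lt0n fact_gt0.
have h0 := lt0r_neq0 (poch_gt0 n (addr_gt0 q0 y0)).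
move: f0 h0; move: (poch p n) (poch q n) (poch (q + y) n) (n`!%:R) => x1 x2 x3 x4 f0 h0.
by field; rewrite ?f0 ?h0.
Qed.

Let ballE (u v : R[i]) (r : R) :
  (ball (u : R[i]^o) r%:C v) = (normc (v - u) < r) :> Prop.
Proof. by rewrite -ball_normE/= distrC normrcE ltcR. Qed.

Let Fcont : star_continuation (hypergeom [:: p%:C; q%:C] [:: (q + y)%:C]) (-1) (F (-1)).
Proof.
exists [set z | normc (z - w) < 3 / 2], F; split; last reflexivity.
- rewrite (_ : [set z | _] = ball (w : R[i]^o) (3 / 2 : R)%:C); last first.
    by apply/seteqP; split => z; rewrite ballE.
  by apply: ball_open; rewrite ltcR; lra.
- move=> u t /= uw /andP[t0 t1].
  (* Star-shapedness follows from convexity of the disc and from 0 being at distance 1/2 from its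
     centre. *)
  rewrite (_ : t%:C * u - w = t%:C * (u - w) + (1 - t)%:C * (0 - w)); last first.
    by rewrite rmorphB rmorph1; ring.
  have w2 : normc (0 - w) = 2^-1.
    by rewrite sub0r /w rmorphN opprK normc_real ger0_norm.
  rewrite (le_lt_trans (normcD _ _))// !Normc.normcM w2 !normc_real.
  rewrite !ger0_norm ?subr_ge0//.
  move: uw; set x := normc (u - w) => uw.
  have tx : t * x <= t * (3 / 2) by rewrite ler_wpM2l// ltW.
  by move: t1; rewrite le_eqVlt => /predU1P[->|t1]; lra.
- split => [u|].
    rewrite discE => u1; change (is_true (normc (u - w) < 3 / 2)).
    rewrite (le_lt_trans (normcB _ _))// normc_real normrN ger0_norm//; lra.
  change (is_true (normc (-1 - w) < 3 / 2)).
  have -> : -1 - w = (- 2^-1)%:C.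
    have -> : -1 = (-1)%:C :> R[i] by rewrite rmorphN rmorph1.
    by rewrite /w -rmorphB/=; congr (_%:C); field.
  by rewrite normc_real normrN ger0_norm//; lra.
- split => u.
    move=> /= uw.
    have [l _ [] //] := @power_series_derive R (fun k => (c k)%:C) F (3 / 2) w u bound Fcvg uw.
  by rewrite discE => u1; rewrite hypE.
Qed.

(* Since -1 is on the boundary of the disc, continuity of the continuation at
   -1 suffices; no identity theorem is needed. *)
Lemma star_continuation_unique (h : R[i] -> R[i]) (l m : R[i]) :
  star_continuation h (-1) l -> star_continuation h (-1) m -> l = m.
Proof.
have lim_seq l' : star_continuation h (-1) l' ->
    (fun n : nat => h (- (1 - n.+1%:R^-1))%:C : R[i]^o) @ \oo --> (l' : R[i]^o).
  move=> [U [G [oU _ [DU U1] [hG Gh] <-]]].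
  have cG : {for (-1 : R[i]^o), continuous (G : R[i]^o -> R[i]^o)}.
    apply: differentiable_continuous; apply/derivable1_diffP; exact: hG.
  rewrite (_ : (fun n => _) = (fun n : nat => G (- (1 - n.+1%:R^-1))%:C)); last first.
    apply/funext => n; rewrite Gh// discE.
    have n0 : 0 < n.+1%:R^-1 :> R by rewrite invr_gt0 ltr0n.
    have n1 : n.+1%:R^-1 <= 1 :> R by rewrite invf_le1 ?ltr0n// ler1n.
    by rewrite normc_real normrN ger0_norm ?subr_ge0// ltrBlDr ltrDl.
  apply: (@cvg_comp _ _ _ (fun n : nat => (- (1 - n.+1%:R^-1))%:C : R[i]^o) G _ _ _ _ cG).
  have -> : (-1 : R[i]) = (- (1 - 0))%:C by rewrite subr0 rmorphN rmorph1.
  apply/cvg_real_complex; apply: cvgN; apply: cvgB; first exact: cvg_cst.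
  exact: cvg_harmonic.
by move=> /lim_seq hl /lim_seq hm; exact: cvgc_unique hl hm.
Qed.

Lemma hyp2F1_m1E :
  hyp2F1 p%:C q%:C (q + y)%:C (-1) = (euler_kernel p q y (- 2^-1))%:C.
Proof.
rewrite /hyp2F1 -Fm1; apply: xget_unique; first exact: Fcont.
by move=> l hl; exact: star_continuation_unique hl Fcont.
Qed.

End hyp2F1_at_m1.

(** * Sums of 2F1 values at -1 *)

Lemma cvg_onem_harmonic (R : realType) :
  (fun m : nat => 1 - m.+1%:R^-1 : R) @ \oo --> (1 : R).
Proof.
have : (fun m : nat => 1 - m.+1%:R^-1 : R) @ \oo --> (1 - 0 : R).
  by apply: cvgB; [exact: cvg_cst|exact: cvg_harmonic].
by rewrite subr0.
Qed.

Section binomial_sum.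
Context (R : realType) (p q y : R).
Hypotheses (p0 : 0 < p) (q0 : 0 < q) (y0 : 0 < y).
Local Notation mu := (@lebesgue_measure R).
Local Notation D := (`]0%R, 1%R[%classic : set R).
Implicit Types s t : R.

Let mD : measurable D. Proof. exact: measurable_itv. Qed.

(** The factor [1 *] keeps the shape a + b t of [measurable_powR_affine]; in [quartic_integral] it
    likewise displays the case r = 1 of 1 + r t^2. *)
Let W t : R := beta_weight q y t * (1 + 1 * t) `^ (- p).

Let mW : measurable_fun D W.
Proof.
by apply: measurable_funM; [exact: measurable_beta_weight|exact: measurable_powR_affine].
Qed.

Let W0 t : 0 <= W t.
Proof. by rewrite mulr_ge0 ?beta_weight_ge0// powR_ge0. Qed.

Let powN_le1 x : 1 <= x -> x `^ (- p) <= 1.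
Proof.
move=> x1; rewrite (le_trans (y := 1 `^ (- p)))//; last by rewrite powR1.
exact: powRN_le.
Qed.

Let measurable_sq (r : R) : measurable_fun D (fun t : R => r * t ^+ 2).
Proof. by apply: measurable_funM => //; exact: measurable_funX. Qed.

Let measurable_powsq (r : R) : measurable_fun D (fun t : R => (1 + r * t ^+ 2) `^ (- p)).
Proof.
by apply: (measurableT_comp (measurable_powR _)); apply: measurable_funD.
Qed.

Let integrableW (f : R -> R) (C : R) : measurable_fun D f ->
  (forall t, 0 < t < 1 -> `|f t| <= C) ->
  mu.-integrable D (EFin \o (fun t => W t * f t)).
Proof.
move=> mf fC; rewrite (_ : (fun t => _) =
    (fun t => beta_weight q y t * ((1 + 1 * t) `^ (- p) * f t))); last first.
  by apply/funext => t; rewrite mulrA.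
apply: (@integrable_beta_weightM _ _ _ _ C) => //.
  by apply: measurable_funM => //; exact: measurable_powR_affine.
move=> t t01; rewrite normrM ger0_norm ?powR_ge0//.
apply: le_trans (fC t t01); rewrite ler_piMl// powN_le1// mul1r lerDl.
by case/andP: t01 => /ltW.
Qed.

Let sq_le1 t : 0 < t < 1 -> 0 <= t ^+ 2 <= 1.
Proof. by move=> /andP[/ltW t0 /ltW t1]; rewrite exprn_ge0// exprn_ile1. Qed.

(* With [y = c - A - B], [p = A], [q = B] this is the integral of
   [t^(B-1) (1-t)^(c-B-1) (1-t^4)^(-A)] over ]0, 1[. *)
Definition quartic_integral : R :=
  \int[mu]_(t in D) (W t * (1 + 1 * t ^+ 2) `^ (- p)).

(** For r < 1 the expansion variable stays below r uniformly in t, so domination is available. At r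
    = 1 the majorant would behave like (1 - t)^(y - 1 - p) near 1, which is not integrable when y <=
    p. *)
Let abel_integral (r : R) : 0 <= r < 1 ->
  series (fun n => binomN p n * (\int[mu]_(t in D) (W t * t ^+ (2 * n))) * r ^+ n) @ \oo -->
  \int[mu]_(t in D) (W t * (1 + r * t ^+ 2) `^ (- p)).
Proof.
move=> /andP[r0 r1].
have u1 t : D t -> `|- (r * t ^+ 2)| <= r.
  rewrite /= in_itv/= => /sq_le1/andP[t0 t1].
  by rewrite normrN ger0_norm; [rewrite ler_piMr|rewrite mulr_ge0].
have [||||||_] := @binomial_Rintegral R D _ p W (fun t => - (r * t ^+ 2)) p0.
- exact: mD.
- exact: mW.
- by apply: measurableT_comp => //; exact: measurable_sq.
- by move=> t _; exact: W0.
- by move=> t Dt; rewrite (le_lt_trans (u1 t Dt)).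
- apply: (@integrableW _ ((1 - r) `^ (- p))).
    apply: (measurableT_comp (measurable_powR _)); apply: measurable_funB => //.
    apply: measurableT_comp => //; exact: measurableT_comp.
  move=> t t01; rewrite ger0_norm ?powR_ge0//; apply: powRN_le => //.
    by rewrite subr_gt0.
  by rewrite lerD2l lerN2 u1//= in_itv.
rewrite (_ : \int[mu]_(t in D) _ =
    \int[mu]_(t in D) (W t * (1 + r * t ^+ 2) `^ (- p))); last first.
  by apply: eq_Rintegral => t _; rewrite opprK.
set a := series _; set b := series _; suff -> : a = b by [].
rewrite /a /b; apply/funext => n; rewrite /series/=; apply: eq_bigr => k _.
have -> : \int[mu]_(t in D) (W t * (- (r * t ^+ 2)) ^+ k) =
    ((- 1) ^+ k * r ^+ k) * \int[mu]_(t in D) (W t * t ^+ (2 * k)).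
  rewrite -RintegralZl//; last first.
    apply: (@integrableW _ 1); first exact: measurable_funX.
    move=> t /andP[/ltW t0 /ltW t1]; rewrite normrX exprn_ile1// ger0_norm//.
  apply: eq_Rintegral => t _.
  have -> : - (r * t ^+ 2) = -1 * r * t ^+ 2 by ring.
  by rewrite exprMn exprMn -exprM mulrCA.
by rewrite /binomN /binc; ring.
Qed.

(** Here domination is easy: 1 + r t^2 >= 1, so every integrand is at most [W]. *)
Let cvg_abel_integral :
  (fun m => \int[mu]_(t in D) (W t * (1 + (1 - m.+1%:R^-1) * t ^+ 2) `^ (- p))) @ \oo -->
    quartic_integral.
Proof.
have m01 (m : nat) : 0 <= 1 - m.+1%:R^-1 :> R.
  by rewrite subr_ge0 invf_le1 ?ltr0n// ler1n.
have [|||||_ c] := @dominated_cvg_Rintegral R D _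
   (fun m t => W t * (1 + (1 - m.+1%:R^-1) * t ^+ 2) `^ (- p))
   (fun t => W t * (1 + 1 * t ^+ 2) `^ (- p)) (fun t => W t * 1).
- exact: mD.
- by move=> m; apply: measurable_funM; [exact: mW|exact: measurable_powsq].
- by apply: (@integrableW _ 1) => // t _; rewrite normr1.
- move=> m t; rewrite /= in_itv/= => /sq_le1/andP[t0 t1].
  rewrite normrM ger0_norm// ler_wpM2l// ger0_norm ?powR_ge0// powN_le1//.
  by rewrite lerDl mulr_ge0.
- move=> t; rewrite /= in_itv/= => /sq_le1/andP[t0 t1].
  apply: cvgMl_tmp.
  apply: (@cvg_comp _ _ _ (fun m : nat => 1 + (1 - m.+1%:R^-1) * t ^+ 2)
    (fun x : R => x `^ (- p)) _ (nbhs (1 + 1 * t ^+ 2))).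
    apply: cvgD; first exact: cvg_cst.
    apply: cvgMr_tmp.
    exact: cvg_onem_harmonic.
  by apply: continuous_powR_gt0; rewrite ltr_pwDl// mul1r.
- exact: c.
Qed.

(** The same integral expanded in powers of t^4. All terms are nonnegative, so the majorant is the
    integrand itself and no Abel argument is needed. The weight has exponent y + p - 1 because 1 -
    t^4 contributes (1 - t)^(-p). *)
Lemma cvg_quartic_integral :
  series (fun n => binc p n * Beta (q + (4 * n)%:R) (y + p)) @ \oo --> quartic_integral.
Proof.
have yp0 : 0 < y + p by exact: addr_gt0.
have WE t : D t -> beta_weight q (y + p) t * (1 - t ^+ 4) `^ (- p) =
    W t * (1 + 1 * t ^+ 2) `^ (- p).
  rewrite /= in_itv/= => /andP[t0 t1].
  have t1' : 0 < 1 - t by rewrite subr_gt0.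
  have -> : 1 - t ^+ 4 = (1 - t) * ((1 + 1 * t) * (1 + 1 * t ^+ 2)) by ring.
  have tt : 0 <= 1 + 1 * t by rewrite mul1r addr_ge0// ltW.
  have tt2 : 0 <= 1 + 1 * t ^+ 2 by rewrite mul1r addr_ge0// exprn_ge0// ltW.
  rewrite powRM ?(ltW t1')// ?mulr_ge0// powRM// /W /beta_weight !mulrA.
  congr (_ * _ * _); rewrite -mulrA; congr (_ * _).
  rewrite -powRD; first by congr (_ `^ _); ring.
  by rewrite (gt_eqF t1') implybT.
have t4 t : D t -> `|t ^+ 4| < 1.
  rewrite /= in_itv/= => /andP[t0 t1].
  by rewrite normrX exprn_ilt1// gtr0_norm.
have [||||||_] := @binomial_Rintegral R D _ p (beta_weight q (y + p)) (fun t => t ^+ 4) p0.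
- exact: mD.
- exact: measurable_beta_weight.
- exact: measurable_funX.
- by move=> t _; exact: beta_weight_ge0.
- exact: t4.
- have := @integrableW (fun t => (1 + 1 * t ^+ 2) `^ (- p)) 1 (measurable_powsq 1) _.
  move=> /(_ _); set P := (X in (X -> _) -> _) => h.
  have /h : P.
    move=> t /sq_le1/andP[t0 t1]; rewrite ger0_norm ?powR_ge0// powN_le1//.
    by rewrite mul1r lerDl.
  apply: eq_integrable => // t /set_mem Dt /=.
  rewrite ger0_norm ?WE// exprn_ge0//.
  by move: Dt; rewrite /= in_itv/= => /andP[/ltW].
rewrite (_ : \int[mu]_(t in D) _ = quartic_integral); last first.
  by apply: eq_Rintegral => t /set_mem Dt; exact: WE.
set a := series _; set b := series _; suff -> : a = b by [].
rewrite /a /b; apply/funext => n; rewrite /series/=; apply: eq_bigr => k _.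
have -> : \int[mu]_(t in D) (beta_weight q (y + p) t * (t ^+ 4) ^+ k) =
    Beta (q + (4 * k)%:R) (y + p); last by [].
have q4 : 0 < q + (4 * k)%:R by rewrite ltr_wpDr.
rewrite -(Rintegral_beta_weight q4 yp0); apply: eq_Rintegral => t.
move=> /set_mem; rewrite /= in_itv/= => /andP[t0 t1].
by rewrite -exprM beta_weightX.
Qed.

(** The Gamma quotient cancels the Beta normalisation of [euler_kernel] up to 1 / Gamma y, so the
    terms are the moments of [W] against t^(2n). Abel's theorem and [cvg_abel_integral] then compute
    the same limit along r = 1 - 1/(m+1). *)
Lemma binomial_hyp2F1_sum (S : R) :
  series (fun n => binomN p n * (Gamma (q + 2 * n%:R) / Gamma (q + y + 2 * n%:R))
     * euler_kernel p (q + 2 * n%:R) y (- 2^-1)) @ \oo --> S ->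
  S = quartic_integral / Gamma y.
Proof.
have gy := lt0r_neq0 (Gamma_gt0 y0).
have termE n : binomN p n * (Gamma (q + 2 * n%:R) / Gamma (q + y + 2 * n%:R))
     * euler_kernel p (q + 2 * n%:R) y (- 2^-1) =
   (Gamma y)^-1 * (binomN p n * \int[mu]_(t in D) (W t * t ^+ (2 * n))).
  have q2 : 0 < q + 2 * n%:R by rewrite ltr_wpDr.
  rewrite /euler_kernel /Beta.
  have -> : \int[mu]_(t in D) (beta_weight (q + 2 * n%:R) y t *
      (1 + 2^-1 * t - t * - 2^-1) `^ (- p)) =
      \int[mu]_(t in D) (W t * t ^+ (2 * n)).
    apply: eq_Rintegral => t /set_mem; rewrite /= in_itv/= => /andP[t0 t1].
    rewrite /W [RHS]mulrAC beta_weightX// natrM; congr (_ * _ `^ _).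
    by field.
  have -> : q + y + 2 * n%:R = q + 2 * n%:R + y by ring.
  have g1 := lt0r_neq0 (Gamma_gt0 q2).
  have g2 := lt0r_neq0 (Gamma_gt0 (addr_gt0 q2 y0)).
  move: gy g1 g2; move: (Gamma y) (Gamma _) (Gamma _) (\int[mu]_(t in D) _) (binomN p n).
  by move=> x1 x2 x3 x4 x5 h1 h2 h3; field; rewrite ?h1 ?h2 ?h3.
set a := (fun n => _) => cS.
have cS' : series (fun n => binomN p n * \int[mu]_(t in D) (W t * t ^+ (2 * n))) @ \oo -->
    Gamma y * S.
  rewrite (_ : series _ = (fun n => Gamma y * series a n)); first exact: cvgMl_tmp.
  apply/funext => n; rewrite /series/= mulr_sumr; apply: eq_bigr => k _.
  by rewrite /a termE mulrA mulfV// mul1r.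
pose r (m : nat) : R := 1 - m.+1%:R^-1.
have r01 m : 0 <= r m < 1.
  by rewrite subr_ge0 ltrBlDr ltrDl invf_le1 ?invr_gt0 ?ltr0n// ler1n.
have r1 : r @ \oo --> (1 : R).
  exact: cvg_onem_harmonic.
have H := abel_limit cS' r01 r1 (fun m => abel_integral (r01 m)).
have := cvg_unique _ H cvg_abel_integral; move=> /(_ (@norm_hausdorff _ _)) E.
by rewrite -E; field.
Qed.

End binomial_sum.

(** * Starlikeness from the coefficients *)

Section coefficient_condition.
Context (R : realType) (t : nat -> R[i]) (T : nat -> R) (lambda s0 s1 : R).
Hypotheses (t0 : t 0 = 1) (T0 : T 0 = 1) (tT : forall n, normc (t n) <= T n)
  (T1 : 0 < T 1) (lambda0 : 0 < lambda)
  (cT : series T @ \oo --> s0)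
  (cT' : series (fun n => n.+1%:R * T n.+1) @ \oo --> s1)
  (s01 : s1 + lambda * s0 <= 2 * lambda).

Let T_ge0 n : 0 <= T n. Proof. exact: le_trans (normc_ge0 _) (tT n). Qed.

Let a (n : nat) : R[i] := if n is m.+1 then t m else 0.

Let G (z : R[i]) : R[i] := limn (series (fun n => t n * z ^+ n : R[i]^o)).

Let f (z : R[i]) : R[i] := z * G z.

Let cG z : normc z < 1 -> series (fun n => t n * z ^+ n : R[i]^o) @ \oo --> (G z : R[i]^o).
Proof.
move=> z1.
have H N : \sum_(n < N) normc (t n * z ^+ n) <= s0.
  apply: le_trans (series_ge0_le T_ge0 cT N); apply: ler_sum => n _.
  rewrite Normc.normcM normcX; apply: le_trans (tT n).
  by rewrite ler_piMr ?normc_ge0// exprn_ile1 ?normc_ge0// ltW.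
have [l cl] := @normc_series_cvg R (fun n => t n * z ^+ n) s0 H.
by rewrite /G (cvg_lim _ cl).
Qed.

Let aS z N : series (fun n => a n * z ^+ n) N.+1 = z * series (fun n => t n * z ^+ n) N.
Proof.
rewrite /series/= big_nat_recl//= mul0r add0r mulr_sumr.
by apply: eq_bigr => i _; rewrite exprS mulrCA.
Qed.

Let cf z : normc z < 1 -> series (fun n => a n * z ^+ n : R[i]^o) @ \oo --> (f z : R[i]^o).
Proof.
move=> z1; rewrite -cvg_shiftS.
rewrite (_ : [sequence _]_n =
    (fun N => z * series (fun n => t n * z ^+ n : R[i]^o) N)); last first.
  by apply/funext => N; exact: aS.
by apply: cvgZl_tmp; exact: cG.
Qed.

Let f_derive z : normc z < 1 ->
  exists2 l : R[i],
    series (fun n => n%:R * a n * z ^+ n.-1 : R[i]^o) @ \oo --> (l : R[i]^o) &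
    @is_derive R[i] R[i]^o R[i]^o z 1 f l.
Proof.
move=> z1.
have Ha rho : 0 <= rho < 1 ->
    exists M, forall N, \sum_(n < N) normc (a n) * rho ^+ n <= M.
  move=> /andP[r0 r1]; exists s0 => -[|N].
    by rewrite big_ord0; have := series_ge0_le T_ge0 cT 0%N; rewrite big_ord0.
  rewrite big_ord_recl (_ : normc (a _) = 0) ?mul0r ?add0r; last exact: Normc.normc0.
  apply: le_trans (series_ge0_le T_ge0 cT N); apply: ler_sum => n _.
  apply: le_trans (tT n).
  by rewrite ler_piMr ?normc_ge0// exprn_ile1// ltW.
have cf0 u : normc (u - 0) < 1 ->
    series (fun n => a n * (u - 0) ^+ n : R[i]^o) @ \oo --> (f u : R[i]^o).
  by rewrite subr0; exact: cf.
have := @power_series_derive R a f 1 0 z Ha cf0.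
by rewrite subr0; apply.
Qed.

(** The second summand on the left is a margin independent of N, so a strict inequality survives the
    passage to the limit. Sums have at least two terms so that n = 1, the source of the margin, is
    always present. *)
Let partial_bound z N (r := normc z) : r < 1 ->
  normc (\sum_(n < N.+2) n%:R * t n * z ^+ n) + (1 + lambda) * T 1 * (1 - r) <=
    lambda * normc (\sum_(n < N.+2) t n * z ^+ n).
Proof.
move=> r1; have r0 : 0 <= r by exact: normc_ge0.
set P := \sum_(n < N.+2) _; set Q := \sum_(n < N.+2) _.
pose p := \sum_(n < N.+1) n.+1%:R * T n.+1 * r ^+ n.+1.
pose q := \sum_(n < N.+1) T n.+1 * r ^+ n.+1.
have Pp : normc P <= p.
  rewrite /P big_ord_recl !mul0r add0r (le_trans (normc_sum _ _ _))//.
  apply: ler_sum => n _; rewrite !Normc.normcM normc_nat normcX.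
  by rewrite ler_wpM2r ?exprn_ge0// ler_wpM2l.
have Qq : 1 - q <= normc Q.
  rewrite lerBlDr.
  have -> : 1 = normc (Q - \sum_(n < N.+1) t n.+1 * z ^+ n.+1).
    by rewrite /Q big_ord_recl t0 mul1r expr0 addrK Normc.normc1.
  rewrite (le_trans (normcB _ _))// lerD2l (le_trans (normc_sum _ _ _))//.
  apply: ler_sum => n _; rewrite Normc.normcM normcX.
  by rewrite ler_wpM2r ?exprn_ge0.
(* As T 0 = 1, the term n = 0 of lambda s0 uses up one of the two lambdas of the hypothesis. *)
have pq : p + lambda * q + (1 + lambda) * T 1 * (1 - r) <= lambda.
  have s0T : 1 + \sum_(n < N.+1) T n.+1 <= s0.
    by have := series_ge0_le T_ge0 cT N.+2; rewrite big_ord_recl T0.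
  have s1T : \sum_(n < N.+1) n.+1%:R * T n.+1 <= s1.
    by apply: series_ge0_le cT' _ => n; rewrite mulr_ge0.
  have -> : p + lambda * q = \sum_(n < N.+1) (n.+1%:R + lambda) * T n.+1 * r ^+ n.+1.
    by rewrite /p /q mulr_sumr -big_split/=; apply: eq_bigr => n _; ring.
  apply: (@le_trans _ _ (\sum_(n < N.+1) (n.+1%:R + lambda) * T n.+1)).
    (* The term n = 1 is kept exactly, through r = 1 - (1 - r); for the others r^n <= 1 is
       enough. *)
    rewrite big_ord_recl [leRHS]big_ord_recl expr1.
    rewrite addrAC; apply: lerD.
      by rewrite le_eqVlt; apply/orP; left; apply/eqP; rewrite /=; ring.
    apply: ler_sum => i _; rewrite ler_piMr ?exprn_ile1 ?(ltW r1)//.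
    by rewrite mulr_ge0// addr_ge0// ltW.
  have -> : \sum_(n < N.+1) (n.+1%:R + lambda) * T n.+1 =
      \sum_(n < N.+1) n.+1%:R * T n.+1 + lambda * \sum_(n < N.+1) T n.+1.
    by rewrite mulr_sumr -big_split/=; apply: eq_bigr => n _; ring.
  have := s01; have : lambda * (1 + \sum_(n < N.+1) T n.+1) <= lambda * s0.
    by rewrite ler_wpM2l// ltW.
  by rewrite mulrDr mulr1; lra.
have : lambda * (1 - q) <= lambda * normc Q by rewrite ler_wpM2l// ltW.
by rewrite mulrBr mulr1; lra.
Qed.

Lemma starlike_of_coef : starlike_class lambda f.
Proof.
split.
  split=> [z|]; first by rewrite discE => /f_derive[l _ []].
  by exists a; split => // z; rewrite discE; exact: cf.
move=> z; rewrite discE => z1 z0.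
have [l cl fl] := f_derive z1.
have fE : f z = z * G z by [].
pose d := (1 + lambda) * T 1 * (1 - normc z).
have d0 : 0 < d by rewrite /d mulr_gt0 ?subr_gt0// mulr_gt0// addr_gt0.
have [P cP lP] : exists2 P : R[i],
    (series (fun n => n%:R * t n * z ^+ n) : nat -> R[i]^o) @ \oo --> (P : R[i]^o) &
    z * l - f z = z * P.
  exists (l - G z); last by rewrite fE mulrBr.
  rewrite (_ : series _ = (fun N => series (fun n => n%:R * a n * z ^+ n.-1 : R[i]^o) N.+1
      - series (fun n => t n * z ^+ n : R[i]^o) N : R[i]^o)).
    apply: (@cvgB _ R[i]^o); last exact: cG.
    by rewrite (cvg_shiftS (series (fun n => n%:R * a n * z ^+ n.-1 : R[i]^o))).
  apply/funext => N; rewrite /series/= big_nat_recl//= !mul0r add0r -sumrB.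
  by apply: eq_bigr => n _; rewrite -natr1; ring.
(* As d > 0, this one inequality yields both that G z is nonzero and the strict bound on P / G z,
   which is z f'(z) / f(z) - 1. *)
have PQ : normc P + d <= lambda * normc (G z).
  have c : (fun N => normc (series (fun n => n%:R * t n * z ^+ n) N.+2) + d -
      lambda * normc (series (fun n => t n * z ^+ n) N.+2)) @ \oo -->
      normc P + d - lambda * normc (G z).
    apply: cvgB.
      apply: cvgD; last exact: cvg_cst.
      by have := cvg_normc cP; rewrite -cvg_shiftS -cvg_shiftS.
    apply: cvgMl_tmp.
    by have := cvg_normc (cG z1); rewrite -cvg_shiftS -cvg_shiftS.
  rewrite -subr_le0; apply: (cvg_le_near c); apply: nearW => N.
  by rewrite /series/= !big_mkord subr_le0; exact: partial_bound.
have G0 : 0 < normc (G z).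
  rewrite -(pmulr_rgt0 _ lambda0) (lt_le_trans _ PQ)//.
  by rewrite ltr_wpDl// normc_ge0.
have Gn0 : G z != 0.
  by apply/eqP => h; move: G0; rewrite h Normc.normc0 ltxx.
split; first by rewrite fE mulf_neq0.
have -> : cderiv f z = l by rewrite /cderiv; exact: derive_val.
have -> : z * l / f z - 1 = P / G z.
  have -> : z * l / f z - 1 = (z * l - f z) / f z.
    by rewrite mulrBl mulfV// fE mulf_neq0.
  by rewrite lP fE -mulf_div mulfV// mul1r.
rewrite normrcE ltcR Normc.normcM Normc.normcV ltr_pdivrMr//.
by rewrite (lt_le_trans _ PQ)// ltrDl.
Qed.

End coefficient_condition.

(** * Coefficients of the 5F4 and conclusion *)

Lemma cvg_real_complex_lim (R : realType) (u : nat -> R) (l : R[i]) :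
  (fun n => (u n)%:C : R[i]^o) @ \oo --> (l : R[i]^o) ->
  exists2 s, l = s%:C & u @ \oo --> s.
Proof.
move=> ul; have us : u @ \oo --> complex.Re l.
  apply/cvgrPdist_lt => e e0; move/cvg_normcP/cvgrPdist_lt : ul => /(_ e e0).
  apply: filterS => n; rewrite sub0r normrN ger0_norm ?normc_ge0//.
  apply: le_lt_trans; rewrite distrC.
  by have := normc_Re ((u n)%:C - l); case: (l).
exists (complex.Re l) => //; apply: (cvgc_unique ul).
exact/cvg_real_complex.
Qed.

(** Gauss multiplication for step 4: each increase of n adds four factors divided by 4, and 256 =
    4^4. The power of 256 cancels between upper and lower parameters. *)
Lemma poch_quarter (K : numFieldType) (x : K) n :
  poch (x / 4) n * poch ((x + 1) / 4) n * poch ((x + 2) / 4) n * poch ((x + 3) / 4) n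
    * 256 ^+ n = poch x (4 * n).
Proof.
elim: n => [|n IHn]; first by rewrite !poch0 expr0; ring.
have -> : (4 * n.+1)%N = (4 * n).+4 by lia.
rewrite !pochS -IHn exprS -[(4 * n).+3%:R]natr1 -[(4 * n).+2%:R]natr1 -[(4 * n).+1%:R]natr1.
rewrite natrM.
move: (poch _ n) (poch _ n) (poch _ n) (poch _ n) (256 ^+ n) => x1 x2 x3 x4 x5.
by field.
Qed.

Section hypergeometric_sums.
Context (R : realType) (A B c : R).
Hypotheses (A0 : 0 < A) (B0 : 0 < B) (ABc : A + B + 1 < c).

(* Taylor coefficients of the 5F4 of the theorem for nonnegative parameters; the
   quarter-integer shifts merge by [poch_quarter]. *)
Definition hyp5F4_coef (n : nat) : R := binc A n * (poch B (4 * n) / poch c (4 * n)).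

Let K : R := Gamma c * Gamma (c - A - B) / (Gamma B * Gamma (c - B)).

Let c0 : 0 < c. Proof. by move: A0 B0 ABc; lra. Qed.
Let cB0 : 0 < c - B. Proof. by move: A0 B0 ABc; lra. Qed.
Let cAB0 : 0 < c - A - B. Proof. by move: A0 B0 ABc; lra. Qed.
Let cAB10 : 0 < c - A - B - 1. Proof. by move: A0 B0 ABc; lra. Qed.

(** Instance p = A, q = B, y = c - A - B of the two expansions of the quartic integral, for which y
    + p = c - B. The constant Gamma c / (Gamma B Gamma (c - B)) is Euler's normalisation 1 / Beta(B,
    c - B). *)
Lemma hyp5F4_coef_sum S :
  series (fun n => binomN A n * (Gamma (B + 2 * n%:R) / Gamma (c - A + 2 * n%:R))
     * euler_kernel A (B + 2 * n%:R) (c - A - B) (- 2^-1)) @ \oo --> S ->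
  series hyp5F4_coef @ \oo --> K * S.
Proof.
set y := c - A - B; have -> : c - A = B + y by rewrite /y; ring.
rewrite {}/y => cS; have SE := binomial_hyp2F1_sum A0 B0 cAB0 cS.
have gB := lt0r_neq0 (Gamma_gt0 B0); have gcB := lt0r_neq0 (Gamma_gt0 cB0).
have gc := lt0r_neq0 (Gamma_gt0 c0); have gy := lt0r_neq0 (Gamma_gt0 cAB0).
have -> : K * S = (Gamma c / (Gamma B * Gamma (c - B))) * quartic_integral A B (c - A - B).
  rewrite SE /K; move: gB gcB gy.
  move: (Gamma _) (Gamma _) (Gamma _) (Gamma _) (quartic_integral _ _ _).
  by move=> x1 x2 x3 x4 x5 h1 h2 h3; field; rewrite ?h1 ?h2 ?h3.
rewrite (_ : series _ = (fun n => (Gamma c / (Gamma B * Gamma (c - B))) *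
    series (fun n => binc A n * Beta (B + (4 * n)%:R) (c - A - B + A)) n)).
  by apply: cvgMl_tmp; exact: cvg_quartic_integral.
apply/funext => n; rewrite /series/= mulr_sumr; apply: eq_bigr => k _.
rewrite /hyp5F4_coef /Beta.
have -> : B + (4 * k)%:R + (c - A - B + A) = c + (4 * k)%:R by ring.
have -> : c - A - B + A = c - B by ring.
rewrite !GammaDn//.
have pc := lt0r_neq0 (poch_gt0 (4 * k) c0).
move: gB gcB gc pc; move: (Gamma _) (Gamma _) (Gamma _) (poch c _) (poch B _) (binc _ _).
by move=> x1 x2 x3 x4 x5 x6 h1 h2 h3 h4; field; rewrite ?h1 ?h2 ?h3 ?h4.
Qed.

(** By [bincSl] and 4 (n + 1) = 4 + 4 n, this is the previous sum with A + 1, B + 4, c + 4 in place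
    of A, B, c, times A, so y drops to c - A - B - 1. The denominator c - A - B - 1 comes from
    rewriting Gamma (c - A - B) by the functional equation. *)
Lemma hyp5F4_coef_deriv_sum S :
  series (fun n => binomN (A + 1) n * (A / (c - A - B - 1)) *
      (Gamma (B + 4 + 2 * n%:R) / Gamma (c - A + 3 + 2 * n%:R))
     * euler_kernel (A + 1) (B + 4 + 2 * n%:R) (c - A - B - 1) (- 2^-1)) @ \oo --> S ->
  series (fun n => n.+1%:R * hyp5F4_coef n.+1) @ \oo --> K * S.
Proof.
have k0 : c - A - B - 1 != 0 by rewrite gt_eqF.
have An0 : A != 0 by rewrite gt_eqF.
have A10 : 0 < A + 1 by rewrite addr_gt0.
have B40 : 0 < B + 4 by rewrite addr_gt0.
have -> : c - A + 3 = B + 4 + (c - A - B - 1) by ring.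
set u := (fun n => _) => cS.
have cS' : series (fun n => binomN (A + 1) n *
    (Gamma (B + 4 + 2 * n%:R) / Gamma (B + 4 + (c - A - B - 1) + 2 * n%:R))
     * euler_kernel (A + 1) (B + 4 + 2 * n%:R) (c - A - B - 1) (- 2^-1)) @ \oo -->
     (c - A - B - 1) / A * S.
  rewrite (_ : series _ = (fun n => (c - A - B - 1) / A * series u n)); first exact: cvgMl_tmp.
  apply/funext => n; rewrite /series/= mulr_sumr; apply: eq_bigr => k _.
  rewrite /u/=; move: k0; move: (Gamma _ / Gamma _) (euler_kernel _ _ _ _) (binomN _ _).
  by move: (c - A - B - 1) => x1 x2 x3 x4 h; field; rewrite ?h ?An0.
have SE := binomial_hyp2F1_sum A10 B40 cAB10 cS'.
have gB := lt0r_neq0 (Gamma_gt0 B0); have gcB := lt0r_neq0 (Gamma_gt0 cB0).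
have gc := lt0r_neq0 (Gamma_gt0 c0); have gy := lt0r_neq0 (Gamma_gt0 cAB10).
have -> : K * S = (A * Gamma c / (Gamma B * Gamma (c - B))) *
    quartic_integral (A + 1) (B + 4) (c - A - B - 1).
  have -> : S = A / (c - A - B - 1) * ((c - A - B - 1) / A * S).
    by move: k0; move: (c - A - B - 1) => x h; field; rewrite ?h ?An0.
  rewrite SE /K.
  have -> : Gamma (c - A - B) = (c - A - B - 1) * Gamma (c - A - B - 1).
    by have := GammaD1 cAB10; rewrite subrK.
  move: gB gcB gy k0; move: (Gamma B) (Gamma (c - B)) (Gamma (c - A - B - 1)) (Gamma c).
  move: (quartic_integral (A + 1) (B + 4) (c - A - B - 1)); move: (c - A - B - 1).
  by move=> x1 x2 x3 x4 x5 x6 h1 h2 h3 h4; field; rewrite ?h1 ?h2 ?h3 ?h4.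
rewrite (_ : series _ = (fun n => (A * Gamma c / (Gamma B * Gamma (c - B))) *
    series (fun n => binc (A + 1) n * Beta (B + 4 + (4 * n)%:R) (c - A - B - 1 + (A + 1))) n)).
  by apply: cvgMl_tmp; exact: cvg_quartic_integral.
apply/funext => n; rewrite /series/= mulr_sumr; apply: eq_bigr => k _.
rewrite /hyp5F4_coef /Beta mulrA bincSl.
have -> : B + 4 + (4 * k)%:R + (c - A - B - 1 + (A + 1)) = c + (4 * k.+1)%:R.
  by rewrite mulnS natrD; ring.
have -> : B + 4 + (4 * k)%:R = B + (4 * k.+1)%:R by rewrite mulnS natrD; ring.
have -> : c - A - B - 1 + (A + 1) = c - B by ring.
rewrite !GammaDn//.
have pc := lt0r_neq0 (poch_gt0 (4 * k.+1) c0).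
move: gB gcB gc pc; move: (Gamma _) (Gamma _) (Gamma _) (poch c _) (poch B _) (binc _ _).
by move=> x1 x2 x3 x4 x5 x6 h1 h2 h3 h4; field; rewrite ?h1 ?h2 ?h3 ?h4.
Qed.

End hypergeometric_sums.

Lemma normc_poch_le (R : realType) (u : R[i]) (x : R) n : normc u <= x ->
  normc (poch u n) <= poch x n.
Proof.
move=> ux; elim: n => [|n IHn]; first by rewrite !poch0 Normc.normc1.
rewrite !pochS Normc.normcM ler_pM ?normc_ge0//.
by rewrite (le_trans (normcD _ _))// normc_nat lerD2r.
Qed.

(** The lower parameters are real and positive, so the denominators agree and only the upper
    Pochhammer symbols are estimated, factor by factor. *)
Lemma normc_hyp5F4_coef_le (R : realType) (a b : R[i]) (c : R) n : 0 < c ->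
  normc ((\prod_(u <- [:: a; b / 4; (b + 1) / 4; (b + 2) / 4; (b + 3) / 4]) poch u n) /
    ((\prod_(l <- [:: c%:C / 4; (c%:C + 1) / 4; (c%:C + 2) / 4; (c%:C + 3) / 4])
        poch l n) * poch 1 n)) <= hyp5F4_coef (normc a) (normc b) c n.
Proof.
move=> c0.
have nb (k : nat) : normc ((b + k%:R) / 4) <= (normc b + k%:R) / 4.
  rewrite Normc.normcM Normc.normcV normc_nat ler_wpM2r//.
  by rewrite (le_trans (normcD _ _))// normc_nat.
have nb1 : normc ((b + 1) / 4) <= (normc b + 1) / 4 by exact: (nb 1).
have nb2 := nb 2; have nb3 := nb 3.
have nb0 : normc (b / 4) <= normc b / 4 by rewrite Normc.normcM Normc.normcV normc_nat.
have cc (k : nat) : (c%:C + k%:R) / 4 = ((c + k%:R) / 4)%:C.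
  by rewrite rmorphM rmorphD fmorphV !rmorph_nat.
have cc0 : c%:C / 4 = (c / 4)%:C by rewrite rmorphM fmorphV rmorph_nat.
have cc1 : (c%:C + 1) / 4 = ((c + 1) / 4)%:C by exact: (cc 1).
rewrite !big_cons !big_nil !mulr1 cc0 cc1 !cc !poch_real poch1 -!rmorphM -fmorphV.
rewrite Normc.normcM normc_real.
have pc k : 0 < poch ((c + k%:R) / 4) n by rewrite poch_gt0// divr_gt0// ltr_wpDr.
have pc1 : 0 < poch ((c + 1) / 4) n by exact: (pc 1).
have pc2 := pc 2; have pc3 := pc 3.
have pc0 : 0 < poch (c / 4) n by rewrite poch_gt0// divr_gt0.
have f0 : 0 < n`!%:R :> R by rewrite ltr0n fact_gt0.
have D0 : 0 < poch (c / 4) n * (poch ((c + 1) / 4) n *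
    (poch ((c + 2) / 4) n * poch ((c + 3) / 4) n)) * n`!%:R.
  by rewrite !mulr_gt0.
rewrite ger0_norm ?invr_ge0 ?(ltW D0)// ler_pdivrMr//.
rewrite /hyp5F4_coef /binc -!poch_quarter.
set x := (X in _ <= X).
have -> : x = poch (normc a) n * (poch (normc b / 4) n * (poch ((normc b + 1) / 4) n *
    (poch ((normc b + 2) / 4) n * poch ((normc b + 3) / 4) n))).
  rewrite /x.
  have h0 := lt0r_neq0 pc0; have h1 := lt0r_neq0 pc1; have h2 := lt0r_neq0 pc2.
  have h3 := lt0r_neq0 pc3; have h4 := lt0r_neq0 f0.
  have h5 : 256 ^+ n != 0 :> R by rewrite expf_neq0 ?pnatr_eq0.
  move: h0 h1 h2 h3 h4 h5.
  move: (poch (c / 4) n) (poch ((c + 1) / 4) n) (poch ((c + 2) / 4) n) (poch ((c + 3) / 4) n).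
  move: (n`!%:R) (256 ^+ n) => x1 x2 x3 x4 x5 x6 h0 h1 h2 h3 h4 h5.
  by field; rewrite ?h0 ?h1 ?h2 ?h3 ?h4 ?h5.
do 4! (rewrite Normc.normcM; apply: ler_pM;
  [exact: normc_ge0|exact: normc_ge0|exact: normc_poch_le|]).
exact: normc_poch_le.
Qed.

(** [limn] has a default value on divergent sequences, so the convergence implicit in the displayed
    bound is stated separately. It is plain convergence of partial sums, not absolute
    convergence. *)
Theorem theorem3p14 (R : realType) (a b : R[i]) (c lambda : R)
    (a_neq0 : a != 0) (b_neq0 : b != 0) (c_gt0 : 0 < c)
    (c_gt : Normc.normc a + Normc.normc b + 1 < c)
    (lambda_gt0 : 0 < lambda) (lambda_le1 : lambda <= 1) :
  let A : R := Normc.normc a in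
  let B : R := Normc.normc b in
  let s1 : nat -> R[i]^o := fun n =>
    (binomN (A + 1) n * (A / (c - A - B - 1))
      * (Gamma (B + 4 + 2 * n%:R) / Gamma (c - A + 3 + 2 * n%:R)))%:C
    * hyp2F1 (A + 1)%:C (B + 4 + 2 * n%:R)%:C (c - A + 3 + 2 * n%:R)%:C (-1) in
  let s2 : nat -> R[i]^o := fun n =>
    (binomN A n * (Gamma (B + 2 * n%:R) / Gamma (c - A + 2 * n%:R)))%:C
    * hyp2F1 A%:C (B + 2 * n%:R)%:C (c - A + 2 * n%:R)%:C (-1) in
  cvgn (series s1) -> cvgn (series s2) ->
  (Gamma c * Gamma (c - A - B) / (Gamma B * Gamma (c - B)))%:C
    * (limn (series s1) + lambda%:C * limn (series s2)) <= (2 * lambda)%:C ->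
  starlike_class lambda (fun z =>
    z * hyp5F4 a (b / 4) ((b + 1) / 4) ((b + 2) / 4) ((b + 3) / 4)
          (c%:C / 4) ((c%:C + 1) / 4) ((c%:C + 2) / 4) ((c%:C + 3) / 4) z).
Proof.
move=> A B s1 s2.
have A0 : 0 < A.
  by rewrite lt_neqAle normc_ge0 andbT; apply: contra a_neq0 => /eqP/esym/Normc.eq0_normc ->.
have B0 : 0 < B.
  by rewrite lt_neqAle normc_ge0 andbT; apply: contra b_neq0 => /eqP/esym/Normc.eq0_normc ->.
have cAB : A + B + 1 < c by exact: c_gt.
have cAB10 : 0 < c - A - B - 1 by lra.
have cAB0 : 0 < c - A - B by lra.
pose x1 n := binomN (A + 1) n * (A / (c - A - B - 1)) *
  (Gamma (B + 4 + 2 * n%:R) / Gamma (c - A + 3 + 2 * n%:R)) *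
  euler_kernel (A + 1) (B + 4 + 2 * n%:R) (c - A - B - 1) (- 2^-1).
pose x2 n := binomN A n * (Gamma (B + 2 * n%:R) / Gamma (c - A + 2 * n%:R)) *
  euler_kernel A (B + 2 * n%:R) (c - A - B) (- 2^-1).
have s1E : series s1 = (fun n => (series x1 n)%:C : R[i]^o).
  apply/funext => n; rewrite /series/= rmorph_sum; apply: eq_bigr => k _.
  (* The third parameter must have the form q + y of [hyp2F1_m1E]; here y = c - A - B - 1 does not
     depend on the index. *)
  have E : c - A + 3 + 2 * k%:R = B + 4 + 2 * k%:R + (c - A - B - 1) by ring.
  rewrite /s1 /x1 E.
  have q2 : 0 < B + 4 + 2 * k%:R by rewrite ltr_wpDr// addr_gt0.
  have A10 : 0 < A + 1 by rewrite addr_gt0.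
  by rewrite hyp2F1_m1E// -rmorphM.
have s2E : series s2 = (fun n => (series x2 n)%:C : R[i]^o).
  apply/funext => n; rewrite /series/= rmorph_sum; apply: eq_bigr => k _.
  have E : c - A + 2 * k%:R = B + 2 * k%:R + (c - A - B) by ring.
  rewrite /s2 /x2 E.
  have q2 : 0 < B + 2 * k%:R by rewrite ltr_wpDr.
  by rewrite hyp2F1_m1E// -rmorphM.
move=> /cvg_ex[/= l1 c1] /cvg_ex[/= l2 c2].
have hR : hausdorff_space R[i]^o by exact: norm_hausdorff.
rewrite (cvg_lim hR c1) (cvg_lim hR c2).
rewrite s1E in c1; rewrite s2E in c2.
(* All terms are real, hence so are the complex limits, and the inequality in [R[i]] becomes one
   between reals. *)
have [S1 -> cS1] := cvg_real_complex_lim c1.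
have [S2 -> cS2] := cvg_real_complex_lim c2.
rewrite -rmorphM -rmorphD -rmorphM lecR => ineq.
have cT := hyp5F4_coef_sum A0 B0 cAB cS2.
have cT' := hyp5F4_coef_deriv_sum A0 B0 cAB cS1.
pose t (n : nat) : R[i] :=
  (\prod_(u <- [:: a; b / 4; (b + 1) / 4; (b + 2) / 4; (b + 3) / 4]) poch u n) /
  ((\prod_(l <- [:: c%:C / 4; (c%:C + 1) / 4; (c%:C + 2) / 4; (c%:C + 3) / 4])
      poch l n) * poch 1 n).
apply: (@starlike_of_coef R t (hyp5F4_coef A B c) lambda _ _ _ _ _ _ lambda_gt0 cT cT').
- by rewrite /t !big_cons !big_nil !poch0 !mulr1 divr1.
- by rewrite /hyp5F4_coef binc0 muln0 !poch0 divr1 mulr1.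
- by move=> n; exact: normc_hyp5F4_coef_le.
- rewrite /hyp5F4_coef bincS binc0 addr0 divr1 mul1r mulr_gt0 ?divr_gt0 ?poch_gt0//.
- by move: ineq; rewrite mulrDr mulrCA.
Qed.
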